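(* For $r\ge0$ let $$V_r(t)=\sum_{k=0}^{r}\frac1{k+1}\binom rk\binom{r+k+2}{k}t^k .$$ For every integer $n\ge1$ and every $\Pi$ in $$\bigl\{\{132,213\},\{132,312\},\{213,231\},\{231,312\}\bigr\},$$ one has $$\sum_{\substack{\mathbf w\in\mathrm{PF}_n\\ \phi(\mathbf w)\text{ avoids }\Pi}}t^{\mathrm{asc}(\phi(\mathbf w))}=V_{n-1}(t),\qquad \sum_{\substack{\mathbf w\in\mathrm{PF}_n\\ \phi(\mathbf w)\text{ avoids }\Pi}}t^{\mathrm{des}(\phi(\mathbf w))}=t^{n-1}V_{n-1}(1/t).$$ The coefficients in the first identity (the ascent polynomial) form displayed row $n+2$ of OEIS A033282, while those in the second identity (the descent polynomial) form displayed row $n$ of OEIS A126216. Both polynomial families $\bigl(V_{n-1}(t)\bigr)_{n\ge1}$ and $\bigl(t^{n-1}V_{n-1}(1/t)\bigr)_{n\ge1}$ have simple negative zeros, and within each family consecutive rows (the polynomials for $n$ and $n+1$) strictly interlace.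
   Context: A parking function of length $n$ is a word $\mathbf w=(w_1,\dots,w_n)\in[n]^n$, $[n]=\{1,\dots,n\}$, whose nondecreasing rearrangement $b_1\le\dots\le b_n$ satisfies $b_i\le i$ for all $i$; $\mathrm{PF}_n$ is the set of these. For $\mathbf w\in\mathrm{PF}_n$ let $B_i(\mathbf w)=\{j\in[n]:w_j=i\}$. The permutation $\phi(\mathbf w)$ of $[n]$ (in one-line notation) is obtained by listing the elements of $B_1(\mathbf w)$ in increasing order, then those of $B_2(\mathbf w)$ in increasing order, and so on, omitting empty blocks. ''$\phi(\mathbf w)$ avoids $\Pi$'' means that the permutation $\phi(\mathbf w)$ avoids, in the classical sense of permutation pattern avoidance, both patterns in $\Pi$. For a permutation $\sigma$ of $[n]$, $\mathrm{asc}(\sigma)$ and $\mathrm{des}(\sigma)$ are the numbers of $1\le i<n$ with $\sigma_i<\sigma_{i+1}$ and $\sigma_i>\sigma_{i+1}$ respectively. OEIS is the On-Line Encyclopedia of Integer Sequences; A033282 and A126216 are number triangles read by rows, and ''displayed row'' refers to the row index used in the OEIS entry (the rows of A033282 start at index 3, so that $V_r$ is the row polynomial of its displayed row $r+3$; the rows of A126216 start at index 1). Coefficients are listed in increasing powers of $t$. Two real-rooted polynomials of degrees $d$ and $d+1$ strictly interlace if, with zeros $a_1<\dots<a_d$ and $b_1<\dots<b_{d+1}$ respectively, $b_1<a_1<b_2<\dots<a_d<b_{d+1}$. *)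

(* Defs.v *)
From HB Require Import structures.
From mathcomp Require Import all_boot all_order all_algebra.
From mathcomp Require Import reals.
Set Implicit Arguments.
Unset Strict Implicit.
Unset Printing Implicit Defensive.
Import Order.TTheory GRing.Theory Num.Theory.
Local Open Scope ring_scope.

(* Letters and positions are shifted by one: the letter i of [n] is the
   ordinal of value i - 1, so the condition b_i <= i is unchanged. *)
Definition parking n (w : n.-tuple 'I_n) : bool :=
  let b := sort leq [seq val x | x <- w] in
  [forall i : 'I_n, (nth 0%N b i <= i)%N].

Definition block n (w : n.-tuple 'I_n) (i : 'I_n) : {set 'I_n} :=
  [set j | tnth w j == i].

(* enum lists the elements of a set of ordinals in increasing order. *)
Definition phi n (w : n.-tuple 'I_n) : seq nat :=
  flatten [seq [seq val j | j <- enum (block w i)] | i <- enum 'I_n].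

Definition order_isomorphic (u v : seq nat) : bool :=
  (size u == size v) &&
  [forall i : 'I_(size u), forall j : 'I_(size u),
     (nth 0 u i < nth 0 u j)%N == (nth 0 v i < nth 0 v j)%N].

Definition contains_pattern (s p : seq nat) : bool :=
  [exists m : (size s).-tuple bool, order_isomorphic (mask m s) p].

Definition avoids (s : seq nat) (Pi : seq (seq nat)) : bool :=
  all (fun p => ~~ contains_pattern s p) Pi.

Definition pattern_pairs : seq (seq (seq nat)) :=
  [:: [:: [:: 1; 3; 2]; [:: 2; 1; 3]];
      [:: [:: 1; 3; 2]; [:: 3; 1; 2]];
      [:: [:: 2; 1; 3]; [:: 2; 3; 1]];
      [:: [:: 2; 3; 1]; [:: 3; 1; 2]]]%N.

Definition asc (s : seq nat) : nat :=
  #|[set i : 'I_(size s).-1 | (nth 0 s i < nth 0 s i.+1)%N]|.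

Definition des (s : seq nat) : nat :=
  #|[set i : 'I_(size s).-1 | (nth 0 s i > nth 0 s i.+1)%N]|.

Definition asc_poly (R : fieldType) (n : nat) (Pi : seq (seq nat)) : {poly R} :=
  \sum_(w : n.-tuple 'I_n | parking w && avoids (phi w) Pi) 'X^(asc (phi w)).

Definition des_poly (R : fieldType) (n : nat) (Pi : seq (seq nat)) : {poly R} :=
  \sum_(w : n.-tuple 'I_n | parking w && avoids (phi w) Pi) 'X^(des (phi w)).

Definition V (R : fieldType) (r : nat) : {poly R} :=
  \sum_(k < r.+1)
    (k.+1%:R^-1 * 'C(r, k)%:R * 'C(r + k + 2, k)%:R) *: 'X^k.

(* The polynomial t^d p(1/t), for p of degree at most d. *)
Definition reciprocal (R : fieldType) (d : nat) (p : {poly R}) : {poly R} :=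
  \sum_(k < d.+1) p`_k *: 'X^(d - k).

Lemma horner_reciprocal (R : fieldType) (d : nat) (p : {poly R}) (x : R) :
  (size p <= d.+1)%N -> x != 0 -> (reciprocal d p).[x] = x ^+ d * p.[x^-1].
Proof.
move=> sp x0; rewrite (horner_coef_wide _ sp) horner_sum mulr_sumr.
apply: eq_bigr => k _; rewrite hornerZ hornerXn mulrCA exprVn.
by rewrite -expfB_cond // (negPf x0) add0n -ltnS.
Qed.

(* OEIS A033282, by its defining description: T(n, k) is the number of diagonal
   dissections of a convex n-gon into k + 1 regions (n >= 3, 0 <= k <= n - 3).
   The vertices are 0, ..., n - 1 in cyclic order; a dissection into k + 1
   regions is a set of k pairwise noncrossing diagonals. *)
Definition is_diagonal n (d : 'I_n * 'I_n) : bool :=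
  (d.1.+1 < d.2)%N && ~~ ((d.1 == 0 :> nat) && (d.2.+1 == n)).

Definition crossing n (d e : 'I_n * 'I_n) : bool :=
  [&& d.1 < e.1, e.1 < d.2 & d.2 < e.2]%N.

Definition is_dissection n (D : {set 'I_n * 'I_n}) : bool :=
  [forall d in D, is_diagonal d] &&
  [forall d in D, forall e in D, ~~ crossing d e].

Definition A033282 (n k : nat) : nat :=
  #|[set D : {set 'I_n * 'I_n} | is_dissection D && (#|D| == k)]|.

Definition A033282_row (n : nat) : seq nat := mkseq (A033282 n) (n - 2).

(* OEIS A126216, by its defining description: T(n, k) is the number of Schroeder
   paths of semilength n containing exactly k peaks but no peaks at level one
   (n >= 1, 0 <= k <= n - 1).  The steps are Up = (1,1), Down = (1,-1) and
   Flat = (2,0). *)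
Inductive step : predArgType := Up | Down | Flat.

Definition step_code (s : step) : option bool :=
  match s with Up => Some true | Down => Some false | Flat => None end.
Definition step_decode (c : option bool) : step :=
  match c with Some true => Up | Some false => Down | None => Flat end.
Lemma step_codeK : cancel step_code step_decode. Proof. by case. Qed.
HB.instance Definition _ := Finite.copy step (can_type step_codeK).

Definition is_schroeder_path (n : nat) (p : seq step) : bool :=
  [&& [forall i : 'I_(size p).+1,
         count_mem Down (take i p) <= count_mem Up (take i p)],
      count_mem Down p == count_mem Up p
    & count_mem Up p + count_mem Flat p == n]%N.

Definition is_peak (p : seq step) (i : nat) : bool :=
  (nth Flat p i == Up) && (nth Flat p i.+1 == Down).

Definition peaks (p : seq step) : nat := count (is_peak p) (iota 0 (size p)).

(* The level of a peak is the height of the path after its up step. *)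
Definition is_level_one_peak (p : seq step) (i : nat) : bool :=
  is_peak p i &&
  (count_mem Up (take i.+1 p) == (count_mem Down (take i.+1 p)).+1).

(* A Schroeder path of semilength n has at most 2n steps. *)
Definition A126216 (n k : nat) : nat :=
  (\sum_(m < (2 * n).+1)
     #|[set p : m.-tuple step |
          [&& is_schroeder_path n p,
              ~~ has (is_level_one_peak p) (iota 0 (size p))
            & peaks p == k]]|)%N.

Definition A126216_row (n : nat) : seq nat := mkseq (A126216 n) n.

(* p has only real zeros, all simple, and a lists them in increasing order. *)
Definition simple_real_zeros (R : realType) (p : {poly R}) (a : seq R) : Prop :=
  [/\ p != 0, sorted <%R a
    & p = lead_coef p *: \prod_(x <- a) ('X - x%:P)].

Definition simple_negative_zeros (R : realType) (p : {poly R}) : Prop :=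
  exists2 a : seq R, simple_real_zeros p a & all (fun x => x < 0) a.

Definition strictly_interlace (R : realType) (p q : {poly R}) : Prop :=
  exists a b : seq R,
    [/\ simple_real_zeros p a, simple_real_zeros q b, size b = (size a).+1
      & forall i, (i < size a)%N -> b`_i < a`_i /\ a`_i < b`_i.+1].

(* Main.v *)
(* For each of the four pairs, an avoiding permutation is determined by its
   descent set, which may be arbitrary.  Hence a counted word is a pair (b, S)
   of a nondecreasing parking function b and a set S of strict ascents of b, the
   descents of phi w.  Generating such pairs letter by letter, dissections by
   splitting the last vertex of the polygon into two, and Schroeder paths
   without level-one peaks by scanning their prefixes, always gives the same
   linear recurrence
     U(n+1, d) = U(n+1, d+1) + a U(n, d-1) + b U(n, d),  U(n, -1) = U(n, 0),
   where d is a lower bound for the position minus the last letter, a lower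
   bound for the degree of the last vertex, and the height minus one.
   Its solution is an explicit product of binomials, and U(n, 0) is V_n(t) for
   (a, b) = (t, 1) and t^n V_n(1/t) for (a, b) = (1, t).  As V_r(t) is a multiple
   of the Jacobi polynomial P_r^(1,1)(1 + 2t), it satisfies a three-term
   recurrence, from which the interlacing of the zeros follows by sign changes
   at -1, the zeros of the previous polynomial, and 0. *)
Require Import Defs.
From mathcomp Require Import all_boot all_order all_algebra.
From mathcomp Require Import reals.
From mathcomp Require Import zify ring lra.
Import Order.TTheory GRing.Theory Num.Theory.
Local Open Scope ring_scope.

(** * Transfer recurrence *)

(** Only uniqueness of the solution links the three families; no bijection between them is built.
    Lower bounds keep the recurrence short: for words and dissections, [U n.+1 d - U n.+1 d.+1]
    isolates the objects whose statistic is exactly [d], and these fall into two classes, each given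
    by one entry of row [n]. For exact values each class would need a tail sum of that row. For
    Schroeder paths the term [U n.+1 d.+1] has another source, a final down step, which changes the
    height but not the number of up and flat steps. The bound [N] is there because words and
    diagonals are taken over a fixed finite set of letters or vertices, large enough only up to row
    [N]. The weights stay free because exchanging [t] and 1 reverses the coefficients, so one closed
    form serves ascents and descents. In the study of the zeros, V_r(t) = P_r^(1,1)(1 + 2t) / (r +
    1), and the points -1 and 0 are the ends of the orthogonality interval [-1, 1] in the variable 1
    + 2t. *)

(* The truncated predecessor encodes the boundary value U n (-1) = U n 0. *)
Definition transfer {R : comNzRingType} (a b : R) (N : nat)
    (U : nat -> nat -> R) : Prop :=
  [/\ forall d, U 0 d = (d == 0)%:R,
      forall n d, (n <= N)%N -> (n < d)%N -> U n d = 0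
    & forall n d, (n < N)%N ->
        U n.+1 d = U n.+1 d.+1 + a * U n d.-1 + b * U n d].

(** Row [n.+1] occurs on both sides of the recurrence, so inside the induction on rows a second one
    descends in [d], starting from [d > n.+1] where both solutions vanish. *)
Lemma transfer_unique {R : comNzRingType} (a b : R) (N : nat)
    (U U' : nat -> nat -> R) :
  transfer a b N U -> transfer a b N U' ->
  forall n d, (n <= N)%N -> U n d = U' n d.
Proof.
move=> [U0 Uz US] [U'0 U'z U'S]; elim=> [|n IH] d leN; first by rewrite U0 U'0.
have [lt_nd|] := ltnP n.+1 d; first by rewrite Uz // U'z.
move: {2}(n.+2 - d)%N (leqnn (n.+2 - d)) => m.
elim: m d => [|m IHm] d lem led; first by lia.
rewrite US // U'S // !IH ?(ltnW leN) //.
have [lt_nd|ge_nd] := ltnP n.+1 d.+1; first by rewrite Uz // [U' _ d.+1]U'z.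
by rewrite IHm //; lia.
Qed.

(** * Closed form of the solution *)

Section ClosedForm.
Context {F : numFieldType}.

(* Lagrange inversion: if z = x (t + z) / (1 - z), this is the coefficient of
   x^(n+1) t^(k+1) in z^(d+1) / (1 - z). *)
Definition kirkman (n d k : nat) : F :=
  if (d <= k)%N then
    'C(n, k)%:R / k.+1%:R * (d.+1 * n.+2 + (k - d))%:R *
    ((n.+1 + (k - d))`!%:R / ((k - d)`!%:R * (n.+2)`!%:R))
  else 0.

Lemma fact_neq0 n : n`!%:R != 0 :> F.
Proof. by rewrite pnatr_eq0 -lt0n fact_gt0. Qed.

Lemma kirkman0 n k :
  kirkman n 0 k = k.+1%:R^-1 * 'C(n, k)%:R * 'C(n + k + 2, k)%:R.
Proof.
rewrite /kirkman leq0n subn0 mul1n mulrC [_ / k.+1%:R]mulrC mulrC -!mulrA.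
congr (_ * (_ * _)).
have := @bin_fact (n + k + 2) k; rewrite (_ : n + k + 2 - k = n.+2)%N; last lia.
move=> /(_ ltac:(lia)) H.
have {H} H : 'C(n + k + 2, k)%:R * (k`!%:R * n.+2`!%:R) = (n + k + 2)`!%:R :> F.
  by rewrite -H !natrM.
have -> : 'C(n + k + 2, k)%:R = (n + k + 2)`!%:R / (k`!%:R * n.+2`!%:R) :> F.
  by rewrite -H mulfK // mulf_neq0 ?fact_neq0.
rewrite (_ : n + k + 2 = (n.+1 + k).+1)%N; last lia.
by rewrite [(n.+1 + k).+1`!]factS natrM mulrA addSn.
Qed.

Lemma kirkman_eq0 n d k : (n < k)%N || (k < d)%N -> kirkman n d k = 0.
Proof.
rewrite /kirkman => /orP [h|h]; last by rewrite leqNgt h.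
by case: ifP => // _; rewrite bin_small // !mul0r.
Qed.

(** This is the recurrence read on the coefficient of a^k b^(n+1-k). Once the common factor
    [A * X / Y / Z] is taken out, it is an identity between rational functions of [n], [k] and
    [d]. *)
Lemma kirkman_rec n d k :
  kirkman n.+1 d k = kirkman n.+1 d.+1 k +
    (if k is k'.+1 then kirkman n d.-1 k' else 0) + kirkman n d k.
Proof.
have [ltkd|ledk] := ltnP k d.
  rewrite !(@kirkman_eq0 _ _ k) ?(ltnW ltkd) ?ltkd ?orbT //; last by rewrite leqW ?orbT.
  by case: k ltkd => [|k] lt; rewrite ?kirkman_eq0 ?addr0 //; apply/orP; right; lia.
have nzS m : m.+1%:R != 0 :> F by rewrite pnatr_eq0.
case: k ledk => [|k] ledk.
  move: ledk; rewrite leqn0 => /eqP ->.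
  rewrite [kirkman _ 1 0]kirkman_eq0 ?orbT // !kirkman0 !bin0 addr0.
  by rewrite add0r.
move: (subnKC ledk); set e := (k.+1 - d)%N => kE.
have binS : 'C(n.+1, k.+1)%:R = n.+1%:R / k.+1%:R * 'C(n, k)%:R :> F.
  apply: (mulfI (nzS k)); rewrite -natrM -mul_bin_diag natrM.
  by field; rewrite nat1r nzS.
have binL : 'C(n, k.+1)%:R = (n%:R - k%:R) / k.+1%:R * 'C(n, k)%:R :> F.
  apply: (mulfI (nzS k)); rewrite -natrM mul_bin_left natrM.
  have [lekn|ltnk] := leqP k n; last by rewrite bin_small // !mulr0.
  by rewrite natrB //; field; rewrite nat1r nzS.
have kF : k.+1%:R = d%:R + e%:R :> F by rewrite -natrD kE.
set A : F := 'C(n, k)%:R / k.+1%:R.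
set X : F := (n.+1 + e)`!%:R; set Y : F := e`!%:R; set Z : F := n.+2`!%:R.
have [Y0 Z0] : Y != 0 /\ Z != 0 by rewrite !fact_neq0.
have ZS : n.+3`!%:R = (n%:R + 3) * Z :> F.
  by rewrite factS natrM -[n.+3]addn3 natrD.
have XS : (n.+2 + e)`!%:R = (n%:R + 2 + e%:R) * X.
  by rewrite addSn factS natrM -natrD -natrD addn2.
have n3 : n%:R + 3 != 0 :> F by rewrite -natrD addn3.
have k1 : k%:R + 1 != 0 :> F by rewrite natr1.
have k2 : k%:R + 2 != 0 :> F by rewrite -natrD addn2.
have succ m : m.+1%:R = m%:R + 1 :> F by rewrite -natr1.
have T1 : kirkman n.+1 d k.+1 =
    A * X / Y / Z * ((n%:R + 1) / (k%:R + 2) * ((d%:R + 1) * (n%:R + 3) + e%:R) *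
                     (n%:R + 2 + e%:R) / (n%:R + 3)).
  rewrite /kirkman ledk -/e binS XS ZS -/Y /A natrD natrM.
  rewrite (succ n.+2) (succ n.+1) (succ n) (succ d) (succ k.+1) (succ k).
  by field; rewrite n3 k1 k2 Y0 Z0.
have T2 : kirkman n.+1 d.+1 k.+1 =
    A * X / Y / Z * ((n%:R + 1) / (k%:R + 2) *
      ((d%:R + 2) * (n%:R + 3) + e%:R - 1) * e%:R / (n%:R + 3)).
  (* For [e = 0] the value is 0 by the [else] branch of [kirkman]; the factor [e] lets the formula
     cover this case too. *)
  rewrite /kirkman subSS; case: (posnP e) => [e0|e_gt0].
    by rewrite e0 !(mulr0, mul0r) ifF //; lia.
  have le_dk : (d <= k)%N by lia.
  have [f fE] : exists f, e = f.+1 by exists e.-1; lia.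
  rewrite ltnS le_dk (_ : k - d = f)%N; last by lia.
  rewrite /Y /X fE factS addnS -addSn ZS -/Z binS /A !natrD !natrM.
  rewrite (succ n.+2) (succ n.+1) (succ n) (succ d.+1) (succ d) (succ k.+1).
  rewrite (succ k) (succ f).
  have f1 : f`!%:R + f%:R * f`!%:R != 0 :> F.
    by rewrite -{1}[f`!%:R]mul1r -mulrDl nat1r mulf_neq0 ?fact_neq0.
  have f0 := fact_neq0 f.
  by field; rewrite n3 k1 k2 f1 f0 Z0.
have T3 : kirkman n d.-1 k = A * X / Y / Z * (d%:R * (n%:R + 2) + e%:R).
  (* At [d = 0] the truncated predecessor selects column 0. The formula for column -1 takes the same
     value, which is the boundary condition. *)
  rewrite /kirkman; case: (posnP d) => [d0|d_gt0].
    have kE' : k.+1 = e by rewrite -kE d0.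
    have XE : X = (n.+1 + k).+1%:R * (n.+1 + k)`!%:R.
      by rewrite /X -kE' addnS factS natrM.
    have YE : Y = k.+1%:R * k`!%:R by rewrite /Y -kE' factS natrM.
    rewrite d0 leq0n subn0 mul1n [(n.+2 + k)%N]addSn -/Z XE YE -kE' /A (succ k).
    by field; rewrite k1 (fact_neq0 k) Z0.
  have -> : (k - d.-1 = e)%N by lia.
  have -> : (d.-1 <= k)%N by lia.
  rewrite prednK // -/X -/Y -/Z /A natrD natrM (succ n.+1) (succ n) (succ k).
  by field; rewrite k1 Y0 Z0.
have T4 : kirkman n d k.+1 = A * X / Y / Z *
    ((n%:R - k%:R) / (k%:R + 2) * ((d%:R + 1) * (n%:R + 2) + e%:R)).
  rewrite /kirkman ledk -/e binL -/X -/Y -/Z /A natrD natrM.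
  rewrite (succ n.+1) (succ n) (succ d) (succ k.+1) (succ k).
  by field; rewrite k1 k2 Y0 Z0.
rewrite T1 T2 T3 T4 -!mulrDr; congr (_ * _).
rewrite (_ : e%:R = k%:R + 1 - d%:R :> F); last by rewrite natr1 kF; ring.
by field; rewrite n3 k2.
Qed.
End ClosedForm.

Section ClosedTransfer.
Context {F : numFieldType}.

Definition kirkman_sum (a b : {poly F}) (n d : nat) : {poly F} :=
  \sum_(k < n.+1) kirkman n d k *: (a ^+ k * b ^+ (n - k)).

Lemma kirkman_transfer (a b : {poly F}) (N : nat) :
  transfer a b N (kirkman_sum a b).
Proof.
split=> [d|n d _ lt_nd|n d _].
- rewrite /kirkman_sum big_ord1 !expr0 mulr1; case: d => [|d].
    by rewrite kirkman0 !bin0 !mulr1 invr1 scale1r.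
  by rewrite kirkman_eq0 ?orbT // scale0r.
- rewrite /kirkman_sum big1 // => k _.
  by rewrite kirkman_eq0 ?scale0r //; apply/orP; right; have := ltn_ord k; lia.
- rewrite /kirkman_sum.
  under eq_bigr do rewrite kirkman_rec !scalerDl.
  rewrite !big_split /= -!addrA; congr (_ + (_ + _)).
    rewrite big_ord_recl scale0r add0r mulr_sumr; apply: eq_bigr => k _ /=.
    by rewrite /bump /= add1n subSS exprS -mulrA -scalerAr.
  rewrite big_ord_recr /= [kirkman n d n.+1]kirkman_eq0 ?ltnSn // scale0r addr0.
  rewrite mulr_sumr; apply: eq_bigr => k _.
  rewrite subSn; last by rewrite -ltnS.
  rewrite exprS -scalerAr; congr (_ *: _).
  by rewrite mulrCA.
Qed.

Lemma kirkman_sum_V n : kirkman_sum 'X 1 n 0 = V F n.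
Proof.
by apply: eq_bigr => k _; rewrite kirkman0 expr1n mulr1.
Qed.

Lemma coef_V n k :
  (V F n)`_k = k.+1%:R^-1 * 'C(n, k)%:R * 'C(n + k + 2, k)%:R.
Proof.
rewrite /V -(poly_def n.+1 (fun k => k.+1%:R^-1 * 'C(n, k)%:R * 'C(n + k + 2, k)%:R)).
rewrite coef_poly; case: ltnP => // h; by rewrite bin_small ?mulr0 ?mul0r.
Qed.

Lemma coef_V_gt0 n k : (k <= n)%N -> 0 < (V F n)`_k.
Proof.
move=> lekn; rewrite coef_V !mulr_gt0 ?invr_gt0 ?ltr0n ?bin_gt0 //.
by rewrite (leq_trans lekn) // -addnA leq_addr.
Qed.

(** Full degree, so that as a list of coefficients [V F n] has exactly the length of the OEIS
    row. *)
Lemma size_V n : size (V F n) = n.+1.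
Proof.
apply/eqP; rewrite eqn_leq; apply/andP; split.
  by apply/leq_sizeP => k lt; rewrite coef_V bin_small ?mulr0 ?mul0r.
rewrite ltnNge; apply/negP => h; have := coef_V_gt0 _ _ (leqnn n).
by rewrite nth_default ?ltxx.
Qed.

Lemma kirkman_sum_reciprocal n : kirkman_sum 1 'X n 0 = reciprocal n (V F n).
Proof.
by apply: eq_bigr => k _; rewrite kirkman0 coef_V expr1n mul1r.
Qed.

Lemma coef_reciprocal n k (p : {poly F}) :
  (k <= n)%N -> (reciprocal n p)`_k = p`_(n - k).
Proof.
move=> lekn; rewrite coef_sum (bigD1 (inord (n - k))) //= inordK ?ltnS ?leq_subr //.
rewrite coefZ coefXn subKn // eqxx mulr1 big1 ?addr0 // => i /eqP ne.
rewrite coefZ coefXn; case: eqP => [E|]; rewrite ?mulr0 //.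
by case: ne; apply: val_inj; rewrite /= inordK ?E ?subKn ?ltnS ?leq_subr // -ltnS.
Qed.

Lemma size_reciprocal_V n : size (reciprocal n (V F n)) = n.+1.
Proof.
apply/eqP; rewrite eqn_leq; apply/andP; split.
  apply/leq_sizeP => k lt; rewrite coef_sum big1 // => i _.
  rewrite coefZ coefXn; case: eqP => [E|]; rewrite ?mulr0 //.
  by have := leq_subr i n; lia.
rewrite ltnNge; apply/negP => h; have := coef_V_gt0 _ _ (leq0n n).
by rewrite -(subnn n) -coef_reciprocal // nth_default ?ltxx.
Qed.

End ClosedTransfer.

(** * Permutations avoiding a pair of patterns *)

(* Each of the four pairs consists of one of 312, 213 (chosen by up) and one of
   132, 231 (chosen by down).  Avoidance forces the last entry, after an ascent,
   to be the maximum (up) or just above its predecessor and, after a descent, to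
   be the minimum (down) or just below its predecessor. *)
Definition forbidden (up down : bool) (x y z : nat) : bool :=
  ((y < z) && (if up then z < x else (y < x) && (x < z))
   || (z < y) && (if down then x < z else (z < x) && (x < y)))%N.

Definition pattern_free (up down : bool) (s : seq nat) : Prop :=
  forall i j k, (i < j)%N -> (j < k)%N -> (k < size s)%N ->
    ~~ forbidden up down (nth 0%N s i) (nth 0%N s j) (nth 0%N s k).

Definition descents (s : seq nat) : seq bool :=
  mkseq (fun i => nth 0%N s i.+1 < nth 0%N s i)%N (size s).-1.

(** An entry [y] between [x] and [c] moves a forbidden triple ending in [c] either before [c] or to
    one with [y] in the middle. Hence appending an entry requires a check only of the triples
    through the last two positions. *)
Lemma forbidden_last up down (a x y c : nat) :
  uniq [:: a; x; y; c] -> forbidden up down a x c ->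
  [|| forbidden up down a x y, forbidden up down a y c
    | forbidden up down x y c].
Proof.
by rewrite /= !inE /forbidden; case: up; case: down => /= *; lia.
Qed.

Lemma pattern_free_rcons up down (s : seq nat) (c : nat) :
  uniq (rcons s c) -> pattern_free up down s ->
  (forall i, (i.+1 < size s)%N ->
     ~~ forbidden up down (nth 0%N s i) (nth 0%N s (size s).-1) c) ->
  pattern_free up down (rcons s c).
Proof.
move=> Us Fs Hc i j k ltij ltjk; rewrite size_rcons ltnS => lek.
have ltj : (j < size s)%N by lia. 
have lti : (i < size s)%N by lia.
rewrite !nth_rcons lti ltj; case: ltnP => [ltk|gek]; first exact: Fs.
rewrite (_ : (k == size s) = true); last by apply/eqP; lia.
have [jE|jne] := eqVneq j (size s).-1; first by rewrite jE; apply: Hc; lia.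
have lt_last : ((size s).-1 < size s)%N by lia.
move: Us; rewrite rcons_uniq => /andP[cs Us].
have cE m : (m < size s)%N -> (nth 0%N s m == c) = false.
  by move=> ltm; apply: contraNF cs => /eqP <-; exact: mem_nth.
have [/negPf ij /negPf il] : i != j /\ i != (size s).-1 by lia.
apply/negP => /(@forbidden_last _ _ _ _ (nth 0%N s (size s).-1)) /=.
rewrite !inE !nth_uniq // !cE // ij il (negPf jne) => /(_ isT) /or3P[]; apply/negP.
- by apply: Fs; lia.
- by apply: Hc; lia.
- by apply: Hc; lia.
Qed.

(** Entries that are at least [c] are raised to free the value [c]. When [c] is the old last entry,
    that entry becomes [c.+1], so the new one lies just below it. *)
Definition extend (up down : bool) (s : seq nat) (d : bool) : seq nat :=
  let c := (if d then (if down then 0 else last 0 s)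
           else (if up then size s else (last 0 s).+1))%N in
  rcons (map (bump c) s) c.

Definition build (up down : bool) (D : seq bool) : seq nat :=
  foldl (extend up down) [:: 0%N] D.

Lemma build_rcons up down D d :
  build up down (rcons D d) = extend up down (build up down D) d.
Proof. by rewrite /build foldl_rcons. Qed.

Lemma size_build up down D : size (build up down D) = (size D).+1.
Proof.
elim/last_ind: D => // D d IH.
by rewrite build_rcons !size_rcons size_map IH.
Qed.

Lemma perm_iota (s : seq nat) :
  uniq s -> (forall x, x \in s -> (x < size s)%N) -> perm_eq s (iota 0 (size s)).
Proof.
move=> Us lts; apply: uniq_perm; rewrite ?iota_uniq //.
case: (@uniq_min_size _ s (iota 0 (size s))) => // [x /lts|]; last by rewrite size_iota.
by rewrite mem_iota.
Qed.

Lemma bump_ltn c x y : (bump c x < bump c y)%N = (x < y)%N.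
Proof. by rewrite /bump; lia. Qed.

Lemma forbidden_bump up down c x y z :
  forbidden up down (bump c x) (bump c y) (bump c z) = forbidden up down x y z.
Proof. by rewrite /forbidden !bump_ltn. Qed.

Lemma build_perm up down D :
  perm_eq (build up down D) (iota 0 (size D).+1).
Proof.
elim/last_ind: D => // D d IH.
have sz := size_build up down (rcons D d).
rewrite -sz build_rcons /extend {sz}.
set s := build up down D in IH *; set c := (if d then _ else _).
have ssz : size s = (size D).+1 by rewrite size_build.
have lts x : x \in s -> (x < size s)%N.
  by rewrite (perm_mem IH) mem_iota ssz.
have lastP : (last 0%N s < size s)%N.
  by apply: lts; rewrite -nth_last mem_nth // ssz.
have lec : (c <= size s)%N by rewrite /c; case: (d); case: (up); case: (down); lia.
apply: perm_iota.
  rewrite rcons_uniq (map_inj_uniq (can_inj (bumpK c))) (perm_uniq IH) iota_uniq.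
  by rewrite andbT; apply/mapP => -[x _ E]; have := neq_bump c x; rewrite -E eqxx.
move=> x; rewrite mem_rcons inE size_rcons size_map => /orP[/eqP->|]; first by lia.
by case/mapP=> y /lts lty ->; rewrite /bump; lia.
Qed.

Lemma build_uniq up down D : uniq (build up down D).
Proof. by rewrite (perm_uniq (build_perm _ _ _)) iota_uniq. Qed.

Lemma descents_rcons (s : seq nat) (c : nat) :
  (0 < size s)%N -> descents (rcons s c) = rcons (descents s) (c < last 0%N s)%N.
Proof.
move=> s_gt0; rewrite /descents size_rcons /= -{1}(prednK s_gt0) mkseqS.
congr rcons; last by rewrite !nth_rcons prednK // ltnn eqxx ifT ?nth_last//; lia.
apply/eq_in_map => i; rewrite mem_iota add0n => /andP[_ lti].
by rewrite !nth_rcons !ifT //; lia.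
Qed.

Lemma descents_bump c s : descents (map (bump c) s) = descents s.
Proof.
rewrite /descents size_map; apply/eq_in_map => i; rewrite mem_iota add0n.
by move=> /andP[_ lti]; rewrite !(nth_map 0%N) ?bump_ltn //; lia.
Qed.

Lemma build_descents up down D : descents (build up down D) = D.
Proof.
elim/last_ind: D => // D d IH.
rewrite build_rcons /extend; set c := (if d then _ else _).
set s := build up down D in IH c *.
have ssz : size s = (size D).+1 by rewrite size_build.
have lts x : x \in s -> (x < size s)%N.
  by rewrite (perm_mem (build_perm _ _ _)) mem_iota ssz.
have ltl : (last 0%N s < size s)%N by apply: lts; rewrite -nth_last mem_nth // ssz.
rewrite descents_rcons; last by rewrite size_map ssz.
rewrite descents_bump IH -nth_last size_map (nth_map 0%N); last by rewrite ssz.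
rewrite nth_last.
congr rcons; rewrite /c /bump; case: d {c}; case: up {s IH ssz lts} (s) ltl;
  case: down => s; lia.
Qed.

Lemma build_pattern_free up down D : pattern_free up down (build up down D).
Proof.
elim/last_ind: D => [|D d IH]; first by move=> i j k /=; lia.
have := build_uniq up down (rcons D d).
rewrite build_rcons /extend; set c := (if d then _ else _) => Us.
set s := build up down D in IH c Us *.
have ssz : size s = (size D).+1 by rewrite size_build.
have lts x : x \in s -> (x < size s)%N.
  by rewrite (perm_mem (build_perm _ _ _)) mem_iota ssz.
apply: pattern_free_rcons => // [i j k ltij ltjk|i]; rewrite size_map => lt.
  by rewrite !(nth_map 0%N) ?forbidden_bump ?IH //; lia.
have lti : (nth 0%N s i < size s)%N by apply/lts/mem_nth/ltnW.
have ltl : (nth 0%N s (size s).-1 < size s)%N by apply/lts/mem_nth; rewrite ssz.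
rewrite !(nth_map 0%N) ?ssz //; last by lia.
rewrite /forbidden /c -nth_last ssz /= in lti ltl *.
move: (nth _ _ _) (nth _ _ _) lti ltl => x y.
by rewrite /bump; case: (d); case: (up); case: (down); lia.
Qed.

(** Induction on the larger position: the descents fix the order of entries [j] and [j.+1], and
    since the triple at [i], [j], [j.+1] is not forbidden, this and the order of entries [i] and [j]
    leave one possible order for [i] and [j.+1]. *)
Lemma pattern_free_compare up down (s s' : seq nat) :
  uniq s -> uniq s' -> size s = size s' -> descents s = descents s' ->
  pattern_free up down s -> pattern_free up down s' ->
  forall i j, (i < size s)%N -> (j < size s)%N ->
    (nth 0 s i < nth 0 s j)%N = (nth 0 s' i < nth 0 s' j)%N.
Proof.
move=> Us Us' Es Ed Fs Fs'.
have U a b : (a < size s)%N -> (b < size s)%N -> (a != b) ->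
    (nth 0 s a != nth 0 s b)%N && (nth 0 s' a != nth 0 s' b)%N.
  by move=> lta ltb ne; rewrite !nth_uniq -?Es // ne.
suff H j i : (i < j)%N -> (j < size s)%N ->
    (nth 0 s i < nth 0 s j)%N = (nth 0 s' i < nth 0 s' j)%N.
  move=> i j lti ltj; have [/H->|gt|->] := ltngtP i j; rewrite ?ltnn //.
  have := H i j gt lti.
  by have /andP[] := U j i ltj lti ltac:(lia); lia.
elim: j i => // j IH i; rewrite ltnS leq_eqVlt => /orP[/eqP-> ltj|ltij ltj].
  have : nth false (descents s) j = nth false (descents s') j by rewrite Ed.
  rewrite !nth_mkseq; [|lia|lia].
  by have /andP[] := U j j.+1 (ltnW ltj) ltj ltac:(lia); lia.
have lti : (i < size s)%N by lia.
have lej := ltnW ltj.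
have := Fs _ _ _ ltij (ltnSn j) ltj.
have := Fs' _ _ _ ltij (ltnSn j); rewrite -Es => /(_ ltj).
have := IH _ ltij lej.
have : nth false (descents s) j = nth false (descents s') j by rewrite Ed.
rewrite !nth_mkseq; [|lia|lia].
have /andP[] := U i j lti lej ltac:(lia).
have /andP[] := U i j.+1 lti ltj ltac:(lia).
have /andP[] := U j j.+1 lej ltj ltac:(lia).
move: (nth 0 s i)%N (nth 0 s j)%N (nth 0 s j.+1)%N (nth 0 s' i)%N (nth 0 s' j)%N
  (nth 0 s' j.+1)%N => a b c a' b' c'.
by rewrite /forbidden; case: (up); case: (down); lia.
Qed.

Lemma perm_compare_eq (s s' : seq nat) :
  perm_eq s (iota 0 (size s)) -> perm_eq s' (iota 0 (size s)) ->
  (forall i j, (i < size s)%N -> (j < size s)%N ->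
    (nth 0 s i < nth 0 s j)%N = (nth 0 s' i < nth 0 s' j)%N) -> s = s'.
Proof.
move=> Ps Ps' H; have Es : size s' = size s by rewrite (perm_size Ps') size_iota.
(* In a permutation of 0, ..., n - 1 each value is the number of smaller entries, so the comparisons
   determine it. *)
have rank (t : seq nat) i : perm_eq t (iota 0 (size t)) -> (i < size t)%N ->
    nth 0%N t i = count (fun j => nth 0 t j < nth 0 t i)%N (iota 0 (size t)).
  move=> Pt lti.
  rewrite -(count_map (nth 0%N t) (fun x => x < nth 0 t i)%N).
  rewrite -/(mkseq _ _) mkseq_nth (permP Pt).
  have : (nth 0 t i < size t)%N.
    by have := mem_nth 0%N lti; rewrite (perm_mem Pt) mem_iota.
  move: (nth _ _ _) (size t) => x m ltm.
  rewrite -(subnKC (ltnW ltm)) iotaD count_cat add0n.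
  rewrite (eq_in_count (a2 := predT)); last by move=> y; rewrite mem_iota.
  rewrite count_predT size_iota (eq_in_count (a2 := pred0)) ?count_pred0 ?addn0 //.
  by move=> y; rewrite mem_iota /=; lia.
apply: (eq_from_nth (x0 := 0%N)) => // i lti.
rewrite rank // [RHS]rank ?Es //.
by apply: eq_in_count => j; rewrite mem_iota => /andP[_ ltj]; rewrite H.
Qed.

Lemma pattern_free_build up down (s : seq nat) :
  (0 < size s)%N -> perm_eq s (iota 0 (size s)) -> pattern_free up down s ->
  build up down (descents s) = s.
Proof.
move=> s_gt0 Ps Fs.
have sD : (size (descents s)).+1 = size s by rewrite size_mkseq prednK.
have sB : size (build up down (descents s)) = size s by rewrite size_build.
apply: perm_compare_eq; rewrite ?sB // ?(perm_trans (build_perm _ _ _)) ?sD //.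
have := @pattern_free_compare up down _ _ (build_uniq up down (descents s)) _ sB.
rewrite build_descents sB; apply => //; last exact: build_pattern_free.
by rewrite (perm_uniq Ps) iota_uniq.
Qed.

(** * Parking functions *)

Lemma subseq_consP (x : nat) (u s : seq nat) :
  reflect (exists2 i, (i < size s)%N & nth 0%N s i = x /\ subseq u (drop i.+1 s))
          (subseq (x :: u) s).
Proof.
apply: (iffP idP) => [|[]].
  elim: s => //= y s IH; case: eqP => [->|_ /IH[i lti [Ei Hi]]].
    by exists 0%N; rewrite //= drop0.
  by exists i.+1.
elim: s => //= y s IH [|i] /= lti [Ei Hi].
  by rewrite Ei eqxx -[s]drop0.
have := IH i lti (conj Ei Hi); case: eqP => // _ h.
exact: subseq_trans (subseq_cons _ _) h.
Qed.

Lemma containsP (s p : seq nat) :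
  reflect (exists2 u, subseq u s & order_isomorphic u p) (contains_pattern s p).
Proof.
apply: (iffP existsP) => [[m om]|[u /subseqP[m sm ->] om]].
  by exists (mask m s) => //; exact: mask_subseq.
have /eqP sm' := sm; by exists (Tuple sm').
Qed.

Lemma contains3P (s : seq nat) (a b c : nat) :
  (exists i j k, [/\ (i < j)%N, (j < k)%N, (k < size s)%N &
     order_isomorphic [:: nth 0 s i; nth 0 s j; nth 0 s k]%N [:: a; b; c]]) <->
  contains_pattern s [:: a; b; c].
Proof.
split=> [[i [j [k [ltij ltjk ltk oi]]]]|/containsP[u us oi]].
  apply/containsP; exists [:: nth 0 s i; nth 0 s j; nth 0 s k]%N => //.
  apply/(subseq_consP); exists i; first by lia.
  split=> //; apply/(subseq_consP); exists (j - i.+1)%N.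
    by rewrite size_drop; lia.
  rewrite nth_drop subnKC // drop_drop; split => //.
  apply/subseq_consP; rewrite (_ : (j - i.+1).+1 + i.+1 = j.+1)%N; last by lia.
  exists (k - j.+1)%N; first by rewrite size_drop; lia.
  by rewrite nth_drop subnKC // sub0seq.
have /andP[/eqP su _] := oi.
case: u su us oi => [|x [|y [|z [|]]]] //= _.
case/(subseq_consP) => i lti [<-] /(subseq_consP)[j].
rewrite size_drop nth_drop drop_drop => ltj [<-] /(subseq_consP)[k].
rewrite size_drop nth_drop => ltk [<- _] oi.
by exists i, (i.+1 + j)%N, (j.+1 + i.+1 + k)%N; split => //; lia.
Qed.

Lemma order_isomorphic3 x y z a b c :
  order_isomorphic [:: x; y; z] [:: a; b; c] =
  [&& (x < y) == (a < b), (y < x) == (b < a), (x < z) == (a < c),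
      (z < x) == (c < a), (y < z) == (b < c) & (z < y) == (c < b)]%N.
Proof.
rewrite /order_isomorphic /=; apply/forallP/idP => [H|H].
  have h i j (li : (i < 3)%N) (lj : (j < 3)%N) :=
    forallP (H (Ordinal li)) (Ordinal lj).
  by rewrite (h 0 1 isT isT) (h 1 0 isT isT) (h 0 2 isT isT) (h 2 0 isT isT)
             (h 1 2 isT isT) (h 2 1 isT isT)%N.
move=> i; apply/forallP => j; case/and5P: H => ? ? ? ? /andP[? ?].
by case: i => -[|[|[|//]]] /= _; case: j => -[|[|[|//]]] /= _; rewrite ?ltnn.
Qed.

Lemma avoids_free (Pi : seq (seq nat)) :
  Pi \in pattern_pairs ->
  exists up down, forall s, avoids s Pi <-> pattern_free up down s.
Proof.
have gen up down s p q :
    (forall x y z, forbidden up down x y z =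
       order_isomorphic [:: x; y; z] p || order_isomorphic [:: x; y; z] q) ->
    size p = 3 -> size q = 3 -> avoids s [:: p; q] <-> pattern_free up down s.
  case: p => [|a [|b [|c [|]]]] //; case: q => [|a' [|b' [|c' [|]]]] //.
  move=> E _ _; rewrite /avoids /= andbT -negb_or.
  split=> [H i j k ltij ltjk ltk|H].
    apply: contra H; rewrite E => /orP[] oi; apply/orP; [left|right];
      by apply/contains3P; exists i, j, k.
  apply/negP => /orP[] /contains3P[i [j [k [ltij ltjk ltk oi]]]];
    by have := H i j k ltij ltjk ltk; rewrite E oi ?orbT.
rewrite /pattern_pairs !inE => /or4P[] /eqP ->.
- exists false, true => s; apply: gen => // x y z.
  by rewrite !order_isomorphic3 /forbidden /=; lia.
- exists true, true => s; apply: gen => // x y z.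
  by rewrite !order_isomorphic3 /forbidden /=; lia.
- exists false, false => s; apply: gen => // x y z.
  by rewrite !order_isomorphic3 /forbidden /=; lia.
- exists true, false => s; apply: gen => // x y z.
  by rewrite !order_isomorphic3 /forbidden /=; lia.
Qed.

Definition letter {n} (w : n.-tuple 'I_n) (j : nat) : nat :=
  nth 0%N [seq val a | a <- w] j.

(** The permutation [phi w] sorts the positions by letter and, for equal letters, by position. This
    strict order characterizes it among all permutations of the positions. *)
Definition phi_lt {n} (w : n.-tuple 'I_n) : rel nat := fun x y =>
  ((letter w x < letter w y) || (letter w x == letter w y) && (x < y))%N.

Lemma phi_lt_trans n (w : n.-tuple 'I_n) : transitive (phi_lt w).
Proof. by move=> y x z; rewrite /phi_lt; lia. Qed.

Lemma phi_lt_irr n (w : n.-tuple 'I_n) : irreflexive (phi_lt w).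
Proof. by move=> x; rewrite /phi_lt; lia. Qed.

Lemma letterE n (w : n.-tuple 'I_n) (j : 'I_n) : letter w j = tnth w j.
Proof. by rewrite /letter (nth_map j) ?size_tuple // -tnth_nth. Qed.

Lemma enum_pairwise n (A : {set 'I_n}) :
  pairwise (fun i j : 'I_n => i < j)%N (enum A).
Proof.
have H : pairwise (fun i j : 'I_n => i < j)%N (enum 'I_n).
  rewrite -(pairwise_map val (fun i j => i < j)%N) val_enum_ord.
  by rewrite -sorted_pairwise ?iota_ltn_sorted //; exact: ltn_trans.
by rewrite enumT in H; rewrite [enum _]/enum_mem pairwise_filter.
Qed.

Lemma phi_sorted n (w : n.-tuple 'I_n) : sorted (phi_lt w) (phi w).
Proof.
apply: pairwise_sorted; rewrite /phi.
have : pairwise (fun i j : 'I_n => i < j)%N (enum 'I_n).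
  by have := @enum_pairwise n setT; rewrite (@eq_enum _ _ 'I_n) // => x; rewrite inE.
have vP i x : x \in [seq val j | j <- enum (block w i)] -> letter w x = i.
  by case/mapP => j; rewrite mem_enum inE => /eqP <- ->; rewrite letterE.
elim: (enum 'I_n) => //= i r IH /andP[/allP lt_ir /IH {}IH].
rewrite pairwise_cat IH andbT; apply/andP; split.
  apply/allrelP => x y /vP xi /flattenP[t /mapP[j /lt_ir ltij ->] /vP yj].
  by rewrite /phi_lt xi yj ltij.
rewrite pairwise_map.
have all_mem : all [in enum (block w i)] (enum (block w i)) by apply/allP.
apply: sub_in_pairwise all_mem (enum_pairwise _ _) => x y.
rewrite !mem_enum !inE => /eqP xi /eqP yi lt.
by rewrite /relpre /= /phi_lt !letterE xi yi eqxx lt orbT.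
Qed.

Lemma mem_phi n (w : n.-tuple 'I_n) x : (x \in phi w) = (x < n)%N.
Proof.
apply/flattenP/idP => [[t /mapP[i _ ->] /mapP[j _ ->]]|ltx]; first exact: ltn_ord.
exists [seq val j | j <- enum (block w (tnth w (Ordinal ltx)))].
  by apply: map_f; rewrite mem_enum.
by apply/mapP; exists (Ordinal ltx); rewrite // mem_enum inE.
Qed.

Lemma phi_uniq n (w : n.-tuple 'I_n) : uniq (phi w).
Proof.
exact: sorted_uniq (@phi_lt_trans _ w) (@phi_lt_irr _ w) _ (phi_sorted _ w).
Qed.

Lemma phi_perm n (w : n.-tuple 'I_n) : perm_eq (phi w) (iota 0 n).
Proof.
by apply: uniq_perm; rewrite ?phi_uniq ?iota_uniq // => x; rewrite mem_phi mem_iota.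
Qed.

Lemma size_phi n (w : n.-tuple 'I_n) : size (phi w) = n.
Proof. by rewrite (perm_size (phi_perm _ w)) size_iota. Qed.

Lemma phi_unique n (w : n.-tuple 'I_n) s :
  perm_eq s (iota 0 n) -> sorted (phi_lt w) s -> phi w = s.
Proof.
move=> Ps Ss; apply: (irr_sorted_eq (@phi_lt_trans _ w) (@phi_lt_irr _ w)) => //.
  exact: phi_sorted.
by move=> x; rewrite (perm_mem Ps) mem_phi mem_iota.
Qed.

(** Since [phi_lt] refines the order of the letters, the parking condition, which concerns the
    sorted letters, can be read along [phi w]. *)
Lemma sort_letters n (w : n.-tuple 'I_n) :
  sort leq [seq val x | x <- w] = [seq letter w x | x <- phi w].
Proof.
apply: (sorted_eq leq_trans anti_leq); first exact: (sort_sorted leq_total).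
  rewrite sorted_map; apply: sub_sorted (phi_sorted _ w) => x y.
  by rewrite /phi_lt /relpre /=; lia.
rewrite perm_sort perm_sym (perm_trans (perm_map _ (phi_perm _ w))) //.
have <- : mkseq (nth 0%N [seq val x | x <- w]) n = [seq val x | x <- w].
  by rewrite -[RHS](mkseq_nth 0%N) size_map size_tuple.
exact: perm_refl.
Qed.

Lemma parkingE n (w : n.-tuple 'I_n) :
  parking w = all (fun i => letter w (nth 0 (phi w) i) <= i)%N (iota 0 n).
Proof.
rewrite /parking sort_letters; apply/forallP/allP => H i.
  rewrite mem_iota => lti; have := H (Ordinal lti).
  by rewrite (nth_map 0%N) // size_phi.
by rewrite (nth_map 0%N) ?size_phi // H // mem_iota /=.
Qed.

Lemma card_ord_count m (P : pred nat) :
  #|[set i : 'I_m | P i]| = count P (iota 0 m).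
Proof.
by rewrite cardsE cardE /enum_mem size_filter -val_enum_ord count_map enumT.
Qed.

Lemma des_count (s : seq nat) : des s = count id (descents s).
Proof.
rewrite /des (card_ord_count _ (fun i => nth 0 s i.+1 < nth 0 s i)%N).
by rewrite count_map.
Qed.

Lemma asc_count (s : seq nat) : uniq s -> asc s = count negb (descents s).
Proof.
move=> Us; rewrite /asc (card_ord_count _ (fun i => nth 0 s i < nth 0 s i.+1)%N).
rewrite count_map; apply: eq_in_count => i.
rewrite mem_iota => lti /=; have lt : (i.+1 < size s)%N by lia.
have := nth_uniq 0%N (ltnW lt) lt Us.
by move: (nth _ _ _) (nth _ _ _) => x y; lia.
Qed.

(* A code lists, from the second entry on, the letters of the nondecreasing
   rearrangement together with the descents of phi w; the first letter is 0. *)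
Definition code_letters {N} (c : seq ('I_N * bool)) : seq nat :=
  0%N :: [seq val p.1 | p <- c].

Definition code_descents {N} (c : seq ('I_N * bool)) : seq bool :=
  [seq p.2 | p <- c].

(** Adding the boolean makes the inequality strict at the descents: [phi] is increasing inside a
    block, so a descent can occur only between two blocks. *)
Definition valid_code {N} (c : seq ('I_N * bool)) : bool :=
  let b := code_letters c in
  all (fun i => (nth 0 b i.+1 <= i.+1) &&
        (nth 0 b i + nth false (code_descents c) i <= nth 0 b i.+1))%N
      (iota 0 (size c)).

Lemma nth_code_letters N (c : seq ('I_N.+1 * bool)) i : (i < size c)%N ->
  nth 0%N (code_letters c) i.+1 = (nth (ord0, false) c i).1.
Proof. by move=> lti; rewrite /= (nth_map (ord0, false)). Qed.

Lemma valid_code_last N (c : seq ('I_N.+1 * bool)) :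
  valid_code c -> (last 0 (code_letters c) <= size c)%N.
Proof.
rewrite -nth_last /= size_map; case sc: (size c) => [//|l] /allP /(_ l).
by rewrite mem_iota sc => /(_ (ltnSn l)) /andP[].
Qed.

Lemma last_code_letters_rcons N (c : seq ('I_N * bool)) p :
  last 0%N (code_letters (rcons c p)) = p.1.
Proof. by rewrite /= map_rcons last_rcons. Qed.

Lemma valid_code_rcons N (c : seq ('I_N.+1 * bool)) p :
  valid_code (rcons c p) =
  [&& valid_code c, (p.1 <= (size c).+1)%N
    & (last 0%N (code_letters c) + p.2 <= p.1)%N].
Proof.
have EL : code_letters (rcons c p) = rcons (code_letters c) p.1.
  by rewrite /code_letters map_rcons.
have ED : code_descents (rcons c p) = rcons (code_descents c) p.2.
  by rewrite /code_descents map_rcons.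
have sL : size (code_letters c) = (size c).+1 by rewrite /= size_map.
have sD : size (code_descents c) = size c by rewrite size_map.
rewrite /valid_code size_rcons -[(size c).+1]addn1 iotaD all_cat EL ED.
rewrite [all _ (iota _ 1)]andbT; congr (_ && _).
  apply: eq_in_all => i; rewrite mem_iota add0n => /andP[_ lti].
  by rewrite !nth_rcons sL sD !ltnS lti (ltnW lti).
by rewrite !add0n !nth_rcons sL sD ltnSn !ltnn !eqxx -nth_last sL addn1.
Qed.

(** Position [x] receives the entry of the nondecreasing rearrangement at the place where [x] occurs
    in the permutation rebuilt from the descents. *)
Definition word_of_code up down {m} (c : seq ('I_m.+1 * bool)) :
    m.+1.-tuple 'I_m.+1 :=
  [tuple inord (nth 0%N (code_letters c)
                  (index (x : nat) (build up down (code_descents c)))) | x < m.+1].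

Definition code_of_word {m} (w : m.+1.-tuple 'I_m.+1) :
    m.-tuple ('I_m.+1 * bool) :=
  [tuple (inord (letter w (nth 0 (phi w) i.+1)),
          nth 0 (phi w) i.+1 < nth 0 (phi w) i)%N | i < m].

Lemma letter_lt m (w : m.+1.-tuple 'I_m.+1) x : (letter w x < m.+1)%N.
Proof.
have [ltx|gex] := ltnP x m.+1; last first.
  by rewrite /letter nth_default // size_map size_tuple.
by rewrite (letterE _ w (Ordinal ltx)) ltn_ord.
Qed.

Lemma code_of_word_descents m (w : m.+1.-tuple 'I_m.+1) :
  code_descents (code_of_word w) = descents (phi w).
Proof.
apply: (@eq_from_nth _ false).
  by rewrite size_map size_tuple size_mkseq size_phi.
move=> i; rewrite size_map size_tuple => lti.
rewrite nth_mkseq ?size_phi // (nth_map (ord0, false)) ?size_tuple //.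
by rewrite -(tnth_nth _ _ (Ordinal lti)) tnth_mktuple.
Qed.

Lemma code_of_word_letter m (w : m.+1.-tuple 'I_m.+1) i :
  parking w -> (i < m.+1)%N ->
  nth 0%N (code_letters (code_of_word w)) i = letter w (nth 0%N (phi w) i).
Proof.
rewrite parkingE => /allP H; case: i => [_|i lti].
  (* The parking condition at index 0 forces the smallest letter to be 0, so a code need not store
     it. *)
  by apply/esym/eqP; rewrite -leqn0; apply: H; rewrite mem_iota.
rewrite nth_code_letters ?size_tuple //.
rewrite -(tnth_nth _ _ (Ordinal (lti : i < m)%N)) tnth_mktuple /=.
by rewrite inordK // letter_lt.
Qed.

Lemma code_of_word_valid m (w : m.+1.-tuple 'I_m.+1) :
  parking w -> valid_code (code_of_word w).
Proof.
move=> Pw; apply/allP => i; rewrite mem_iota size_tuple => /andP[_ lti].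
have lti1 : (i < m.+1)%N by lia.
have := phi_sorted _ w => /(sortedP 0%N) /(_ i).
rewrite code_of_word_descents nth_mkseq ?size_phi // !code_of_word_letter //.
move: (Pw); rewrite parkingE => /allP /(_ i.+1) ->; last by rewrite mem_iota.
move=> /(_ lti); rewrite /phi_lt; move: (nth _ _ _) (nth _ _ _) => x y; lia.
Qed.

Lemma code_of_wordK up down m (w : m.+1.-tuple 'I_m.+1) :
  parking w -> pattern_free up down (phi w) ->
  word_of_code up down (code_of_word w) = w.
Proof.
move=> Pw Fw; apply: eq_from_tnth => x; rewrite tnth_mktuple.
rewrite code_of_word_descents pattern_free_build ?size_phi ?phi_perm //.
have xin : (x : nat) \in phi w by rewrite mem_phi.
rewrite code_of_word_letter //; last by rewrite -index_mem size_phi in xin.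
by rewrite nth_index // letterE inord_val.
Qed.

Section CodeWord.
Context (up down : bool) (m : nat) (c : m.-tuple ('I_m.+1 * bool)).
Context (Vc : valid_code c).

Let w := word_of_code up down c.
Let s := build up down (code_descents c).

Let size_s : size s = m.+1.
Proof. by rewrite size_build size_map size_tuple. Qed.

Let letter_w i : (i < m.+1)%N ->
  letter w (nth 0%N s i) = nth 0%N (code_letters c) i.
Proof.
move=> lti; have lts : (nth 0%N s i < m.+1)%N.
  have : nth 0%N s i \in s by rewrite mem_nth ?size_s.
  by rewrite (perm_mem (build_perm _ _ _)) mem_iota size_map size_tuple.
rewrite (letterE _ w (Ordinal lts)) tnth_mktuple /=.
rewrite index_uniq ?size_s ?build_uniq // inordK //.
by case: i lti {lts} => // i lti; rewrite nth_code_letters ?size_tuple.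
Qed.

(** Validity makes [s] sorted for [phi_lt]: the letters weakly increase along [s], and a tie
    excludes a descent, so the positions increase there. *)
Lemma phi_word_of_code : phi w = s.
Proof.
apply: phi_unique.
  by have := build_perm up down (code_descents c); rewrite size_map size_tuple.
apply/(sortedP 0%N) => i; rewrite size_s => lti.
rewrite /phi_lt !letter_w //; last by lia.
have /allP /(_ i) := Vc; rewrite mem_iota size_tuple => /(_ lti) /andP[_].
have := build_descents up down (code_descents c) => <-.
rewrite -/s nth_mkseq ?size_s //.
have := nth_uniq 0%N (i := i) (j := i.+1) (s := s) _ _ (build_uniq _ _ _).
rewrite size_s => /(_ (ltnW lti) lti).
by move: (nth _ s _) (nth _ s _) => x y; lia.
Qed.

Lemma word_of_code_parking : parking w.
Proof.
rewrite parkingE phi_word_of_code; apply/allP => i; rewrite mem_iota => lti.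
rewrite letter_w //; case: i lti => // i lti.
by have /allP /(_ i) := Vc; rewrite mem_iota size_tuple => /(_ lti) /andP[].
Qed.

Lemma word_of_codeK : code_of_word w = c.
Proof.
apply: eq_from_tnth => i; rewrite tnth_mktuple phi_word_of_code.
rewrite letter_w ?ltnS // nth_code_letters ?size_tuple // -tnth_nth inord_val.
have := build_descents up down (code_descents c).
move/(congr1 (fun t => nth false t i)); rewrite -/s /descents size_s nth_mkseq // => ->.
by rewrite (nth_map (ord0, false)) ?size_tuple // -tnth_nth; case: (tnth c i).
Qed.

End CodeWord.

Section ParkingTransfer.
Context {R : comNzRingType} (a b : R).

Definition code_weight {N} (c : seq ('I_N * bool)) : R :=
  a ^+ count negb (code_descents c) * b ^+ count id (code_descents c).

Lemma code_weight_rcons N (c : seq ('I_N * bool)) p :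
  code_weight (rcons c p) = code_weight c * (if p.2 then b else a).
Proof.
rewrite /code_weight /code_descents map_rcons -cats1 !count_cat !exprD /=.
by case: p.2; rewrite /= expr0 expr1; ring.
Qed.

(** The alphabet ['I_N] stays fixed while the length [l] varies, so that consecutive rows are sums
    over words in the same letters. *)
Definition code_sum N (l d : nat) : R :=
  \sum_(c : l.-tuple ('I_N * bool) |
         valid_code c && (last 0 (code_letters c) + d <= l)%N) code_weight c.

Lemma parking_sum_code m (Pi : seq (seq nat)) :
  Pi \in pattern_pairs ->
  \sum_(w : m.+1.-tuple 'I_m.+1 | parking w && avoids (phi w) Pi)
     a ^+ asc (phi w) * b ^+ des (phi w) = code_sum m.+1 m 0.
Proof.
case/avoids_free => up [down H].
rewrite (reindex_onto (fun c : m.-tuple ('I_m.+1 * bool) => word_of_code up down c)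
  code_of_word) /=; last first.
  by move=> w /andP[Pw /H Fw]; exact: code_of_wordK.
have E (c : m.-tuple ('I_m.+1 * bool)) :
  (parking (word_of_code up down c) && avoids (phi (word_of_code up down c)) Pi
    && (code_of_word (word_of_code up down c) == c)) =
  valid_code c && (last 0 (code_letters c) + 0 <= m)%N.
  apply/idP/idP => [/andP[/andP[Pw _] /eqP E]|/andP[Vc _]].
    rewrite -{1}E code_of_word_valid //= addn0 -/(code_letters c).
    have Vc : valid_code c by rewrite -E code_of_word_valid.
    by have := valid_code_last _ _ Vc; rewrite size_tuple.
  rewrite word_of_code_parking // word_of_codeK // eqxx phi_word_of_code // andbT.
  by apply/H/build_pattern_free.
rewrite (eq_bigl _ _ E); apply: eq_bigr => c /andP[Vc _].
by rewrite asc_count ?phi_uniq // des_count phi_word_of_code // build_descents.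
Qed.

Lemma big_tuple_rcons (T : finType) l (F : seq T -> R) :
  \sum_(c : l.+1.-tuple T) F c = \sum_(c : l.-tuple T) \sum_x F (rcons c x).
Proof.
rewrite pair_big /=.
rewrite (reindex (fun p : l.-tuple T * T => [tuple of rcons p.1 p.2])) //=.
apply: onW_bij; apply: inj_card_bij => [[s x] [t y] /(congr1 val) /rcons_inj[] E ->|].
  by congr pair; apply: val_inj.
by rewrite card_prod !card_tuple expnSr.
Qed.

Lemma sum_ord_if N (P : nat -> bool) n d (y : R) : (n < N)%N ->
  \sum_(x < N) (if P x && (x + d == n)%N then y else 0) =
  if (d <= n)%N && P (n - d)%N then y else 0.
Proof.
move=> ltn; rewrite -big_mkcond /=; have [led|gtd] := leqP d n; last first.
  by rewrite big_pred0 // => x; apply/negP => /andP[_ /eqP]; lia.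
have ltx : (n - d < N)%N by lia.
rewrite andTb; case: ifP => [Px|nPx].
  rewrite (big_pred1 (Ordinal ltx)) // => x /=.
  apply/andP/eqP => [[_ /eqP E]|->]; first by apply: val_inj => /=; lia.
  by rewrite Px subnK.
rewrite big_pred0 // => x; apply/andP => -[Px /eqP E].
by move: nPx; rewrite -E addnK Px.
Qed.

(** Passing from column [d.+1] to [d] adds the codes with last letter exactly [l.+1 - d]. A final
    non-descent allows the previous letter to reach this value, a final descent keeps it below;
    these are columns [d.-1] and [d] of row [l]. *)
Lemma code_transfer m : transfer a b m (code_sum m.+1).
Proof.
split=> [d|n d _ ltnd|l d ltlm].
- rewrite /code_sum big_mkcond (big_pred1 [tuple]) => [|c]; last by rewrite [c]tuple0.
  by rewrite /= /code_weight /= mulr1; case: d.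
- by rewrite /code_sum big_pred0 // => c; apply/negP => /andP[_]; lia.
- pose G (P : nat -> bool) (c : seq ('I_m.+1 * bool)) (p : 'I_m.+1 * bool) : R :=
    if [&& valid_code c, last 0 (code_letters c) + p.2 <= p.1 & P p.1]%N
    then code_weight c * (if p.2 then b else a) else 0.
  have E e : code_sum m.+1 l.+1 e =
      \sum_(c : l.-tuple ('I_m.+1 * bool)) \sum_p G (fun x => x + e <= l.+1)%N c p.
    rewrite /code_sum big_mkcond.
    rewrite (big_tuple_rcons _ _ (fun c => if valid_code c &&
      (last 0 (code_letters c) + e <= l.+1)%N then code_weight c else 0)).
    apply: eq_bigr => c _; apply: eq_bigr => p _.
    rewrite valid_code_rcons size_tuple last_code_letters_rcons /G.
    rewrite (_ : _ && _ = [&& valid_code c, last 0 (code_letters c) + p.2 <= p.1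
      & p.1 + e <= l.+1]%N).
      by case: ifP => // _; rewrite code_weight_rcons.
    move: (valid_code c) (last _ _) (nat_of_ord _) (nat_of_bool _) => v x y z; lia.
  rewrite !E -addrA.
  have -> : a * code_sum m.+1 l d.-1 + b * code_sum m.+1 l d =
      \sum_(c : l.-tuple ('I_m.+1 * bool)) \sum_p G (fun x => x + d == l.+1)%N c p.
    rewrite /code_sum !mulr_sumr big_mkcond [X in _ + X]big_mkcond -big_split.
    apply: eq_bigr => c _ /=; rewrite -(pair_bigA _ (fun x e => G _ c (x, e))) /=.
    rewrite exchange_big big_bool /G /=.
    have Gs (e : bool) y : \sum_(x < m.+1) (if [&& valid_code c,
          last 0 (code_letters c) + e <= x & x + d == l.+1]%N then y else 0) =
        if valid_code c && (last 0 (code_letters c) + e + d <= l.+1)%N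
        then y else 0 :> R.
      under eq_bigr do rewrite andbA.
      rewrite (sum_ord_if m.+1 (fun x => valid_code c &&
        (last 0 (code_letters c) + e <= x)%N)) //.
      by congr (if _ then _ else _); case: (valid_code c); rewrite ?andbF //=; lia.
    rewrite (Gs true) (Gs false) addrC; congr (_ + _).
      rewrite addn1 addSn ltnS; case: ifP => // _; exact: mulrC.
    rewrite addn0 [a * _]mulrC; congr (if _ then _ else _).
    (* For [d = 0] the two bounds to compare are [l] and [l.+1]; the last letter of a valid code of
       length [l] satisfies both. *)
    have [Vc|//] := boolP (valid_code c).
    have := valid_code_last _ _ Vc; rewrite size_tuple /=.
    by case: (d) => [|?]; move: (last _ _) => x; lia.
  rewrite -big_split; apply: eq_bigr => c _; rewrite -big_split.
  apply: eq_bigr => p _; rewrite /G /=.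
  case: (valid_code c) => /=; last by rewrite addr0.
  case: leqP => _ /=; last by rewrite addr0.
  rewrite addnS; case: ltngtP => _; rewrite ?addr0 ?add0r //.
Qed.

End ParkingTransfer.

(** * Schroeder paths *)

Definition schroeder_prefix (p : seq step) : bool :=
  [forall i : 'I_(size p).+1,
     (count_mem Down (take i p) <= count_mem Up (take i p))%N]
  && ~~ has (is_level_one_peak p) (iota 0 (size p)).

Lemma forall_ord_iota m (P : pred nat) : [forall i : 'I_m, P i] = all P (iota 0 m).
Proof.
apply/forallP/allP => H i; last by rewrite H // mem_iota ltn_ord.
by rewrite mem_iota => lti; exact: (H (Ordinal lti)).
Qed.

Lemma is_peak_rcons p s i : (i.+1 < size p)%N -> is_peak (rcons p s) i = is_peak p i.
Proof. by move=> lti; rewrite /is_peak !nth_rcons (ltnW lti) lti. Qed.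

Lemma is_peak_last p i : (size p <= i.+1)%N -> is_peak p i = false.
Proof. by move=> lei; rewrite /is_peak (nth_default _ lei) andbF. Qed.

Lemma is_peak_rcons2 p u s :
  is_peak (rcons (rcons p u) s) (size p) = (u == Up) && (s == Down).
Proof.
by rewrite /is_peak !nth_rcons !size_rcons !ltnSn !ltnn !eqxx.
Qed.

Lemma peaks_rcons p s :
  peaks (rcons p s) = (peaks p + ((last Flat p == Up) && (s == Down)))%N.
Proof.
case/lastP: p => [|p u]; first by rewrite /peaks /= is_peak_last.
rewrite last_rcons /peaks !size_rcons -addn2 -[(size p).+1]addn1 !iotaD !count_cat.
rewrite /= !add0n is_peak_rcons2 !is_peak_last ?size_rcons ?addn1 // !addn0.
congr (_ + _)%N; apply: eq_in_count => i; rewrite mem_iota => /andP[_ lti].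
by rewrite is_peak_rcons // size_rcons ltnS.
Qed.

Lemma level_one_rcons p s :
  has (is_level_one_peak (rcons p s)) (iota 0 (size (rcons p s))) =
  has (is_level_one_peak p) (iota 0 (size p)) ||
  [&& last Flat p == Up, s == Down & count_mem Up p == (count_mem Down p).+1].
Proof.
case/lastP: p => [|p u].
  by rewrite /= /is_level_one_peak is_peak_last.
rewrite last_rcons !size_rcons -addn2 -[(size p).+1]addn1 !iotaD !has_cat.
rewrite /= /is_level_one_peak !add0n is_peak_rcons2.
rewrite !is_peak_last ?size_rcons ?addn1 //= !orbF -andbA.
rewrite (_ : take _ (rcons (rcons p u) s) = rcons p u); last first.
  by rewrite -cats1 take_size_cat // size_rcons.
congr (_ || _); apply: eq_in_has => i; rewrite mem_iota => /andP[_ lti].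
have lei : (i.+1 <= size (rcons p u))%N by rewrite size_rcons leqW.
by rewrite is_peak_rcons ?size_rcons ?ltnS // -(cats1 (rcons p u)) (takel_cat _ lei).
Qed.

Lemma schroeder_prefix_rcons p s :
  schroeder_prefix (rcons p s) =
  [&& schroeder_prefix p,
      (count_mem Down (rcons p s) <= count_mem Up (rcons p s))%N
    & ~~ [&& last Flat p == Up, s == Down
           & count_mem Up p == (count_mem Down p).+1]].
Proof.
rewrite /schroeder_prefix level_one_rcons negb_or.
rewrite !(forall_ord_iota _
  (fun i => count_mem Down (take i _) <= count_mem Up (take i _))%N).
rewrite size_rcons -[(size p).+2]addn1 iotaD all_cat [all _ (iota _ 1)]andbT.
rewrite -[take (0 + _) _](_ : rcons p s = _); last first.
  by rewrite take_oversize // size_rcons.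
rewrite (_ : all _ (iota 0 (size p).+1) = 
  all (fun i => count_mem Down (take i p) <= count_mem Up (take i p))%N
      (iota 0 (size p).+1)).
  by case: (all _ _); case: (has _ _); case: (_ <= _)%N.
apply: eq_in_all => i; rewrite mem_iota => /andP[_ lti].
by rewrite -cats1 takel_cat.
Qed.

Lemma schroeder_prefix_height p :
  schroeder_prefix p -> (count_mem Down p <= count_mem Up p)%N.
Proof. by move/andP => [/forallP /(_ ord_max)]; rewrite take_size. Qed.

Lemma count_steps p :
  (count_mem Up p + count_mem Down p + count_mem Flat p)%N = size p.
Proof. by elim: p => //= s p <-; case: s => /=; lia. Qed.

Lemma count_rcons (T : Type) (a : pred T) p s :
  count a (rcons p s) = (count a p + a s)%N.
Proof. by rewrite -cats1 count_cat /= addn0. Qed.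

Section SchroederTransfer.
Context {R : comNzRingType} (t : R).

(** The number [n] of up and flat steps is the semilength once the height [h] is back at 0. Being
    defined on all step sequences, with value 0 off the admissible ones, the weight can be summed
    over any range of lengths. *)
Definition prefix_weight (n h : nat) (p : seq step) : R :=
  if [&& schroeder_prefix p, count_mem Up p + count_mem Flat p == n
       & count_mem Up p == count_mem Down p + h]%N
  then t ^+ peaks p else 0.

Definition up_weight (n h : nat) (p : seq step) : R :=
  if last Flat p == Up then prefix_weight n h p else 0.

Lemma prefix_weight_Up n h p :
  prefix_weight n.+1 h (rcons p Up) = if h is h'.+1 then prefix_weight n h' p else 0.
Proof.
rewrite /prefix_weight schroeder_prefix_rcons peaks_rcons !count_rcons /= !andbF addn0.
have := schroeder_prefix_height p.
move: (count_mem Up p) (count_mem Flat p) (count_mem Down p) => u f d.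
case: (schroeder_prefix p) => /= [/(_ isT) le|_].
  case: h => [|h]; first by rewrite ifF //; lia.
  by rewrite !addn0; congr (if _ then _ else _); lia.
by case: h.
Qed.

Lemma prefix_weight_Flat n h p :
  prefix_weight n.+1 h (rcons p Flat) = prefix_weight n h p.
Proof.
rewrite /prefix_weight schroeder_prefix_rcons peaks_rcons !count_rcons /= !andbF !addn0.
have := schroeder_prefix_height p.
move: (count_mem Up p) (count_mem Flat p) (count_mem Down p) => u f d.
case: (schroeder_prefix p) => //= /(_ isT) le.
by rewrite le addnA addn1 eqSS.
Qed.

Lemma prefix_weight_Down n h p :
  prefix_weight n h (rcons p Down) =
  if last Flat p == Up then (if h == 0%N then 0 else t * prefix_weight n h.+1 p)
  else prefix_weight n h.+1 p.
Proof.
rewrite /prefix_weight schroeder_prefix_rcons peaks_rcons !count_rcons /= !andbT !addn0.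
move: (count_mem Up p) (count_mem Flat p) (count_mem Down p) => u f d.
case: (schroeder_prefix p) => /=; last by rewrite mulr0 !if_same.
case: eqP => _ /=; last first.
  by rewrite !addn0; congr (if _ then _ else _); lia.
(* At [h = 0] the prefix ends in an up step to height one, so the down step would complete a
   forbidden peak. *)
case: h => [|h] /=; first by rewrite ifF //; lia.
rewrite [t * _](fun_if ( *%R t)) mulr0 !addn1 exprS; congr (if _ then _ else _); lia.
Qed.

Lemma big_step (F : step -> R) : \sum_s F s = F Up + F Down + F Flat.
Proof.
rewrite (bigD1 Up) //= (bigD1 Down) //= (bigD1 Flat) //= big_pred0 ?addr0 ?addrA //.
by case.
Qed.

Definition short_sum M (f : seq step -> R) : R :=
  \sum_(m < M) \sum_(p : m.-tuple step) f p.

(** Sequences of length [M] or more weigh nothing, so the range of lengths can be enlarged by one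
    before the last step is split off, and the new sum has the old range. *)
Lemma short_sum_rcons M f :
  (forall p, (M <= size p)%N -> f p = 0) ->
  short_sum M f = f [::] + short_sum M (fun p => \sum_s f (rcons p s)).
Proof.
move=> f0; have -> : short_sum M f = short_sum M.+1 f.
  rewrite /short_sum big_ord_recr /= [X in _ + X]big1 ?addr0 // => p _.
  by rewrite f0 // size_tuple.
rewrite /short_sum big_ord_recl; congr (_ + _).
  by rewrite (big_pred1 [tuple]) // => p; rewrite [p]tuple0.
by apply: eq_bigr => m _; rewrite big_tuple_rcons.
Qed.

Lemma short_sumD M f g :
  short_sum M (fun p => f p + g p) = short_sum M f + short_sum M g.
Proof.
by rewrite /short_sum -big_split; apply: eq_bigr => m _; rewrite -big_split.
Qed.

Lemma short_sumZ M c f : short_sum M (fun p => c * f p) = c * short_sum M f.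
Proof.
by rewrite /short_sum mulr_sumr; apply: eq_bigr => m _; rewrite mulr_sumr.
Qed.

Lemma eq_short_sum M f g : f =1 g -> short_sum M f = short_sum M g.
Proof. by move=> fg; apply: eq_bigr => m _; apply: eq_bigr => p _. Qed.

Lemma prefix_weight_long n h p : (2 * n < size p)%N -> prefix_weight n h p = 0.
Proof.
rewrite /prefix_weight -count_steps => lt; rewrite ifF //.
by apply/negP => /and3P[/schroeder_prefix_height]; lia.
Qed.

Definition prefix_sum N n h : R := short_sum (2 * N).+1 (prefix_weight n h).

Lemma up_sum N n h : (n < N)%N ->
  short_sum (2 * N).+1 (up_weight n.+1 h.+1) = prefix_sum N n h.
Proof.
move=> ltn; rewrite short_sum_rcons => [|p lep].
  rewrite {1}/up_weight /= add0r; apply: eq_short_sum => p.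
  by rewrite big_step /up_weight !last_rcons /= !addr0 prefix_weight_Up.
by rewrite /up_weight prefix_weight_long ?if_same //; lia.
Qed.

Lemma prefix_sum_recS N n h : (n < N)%N ->
  prefix_sum N n.+1 h.+1 =
  prefix_sum N n.+1 h.+2 + prefix_sum N n h + t * prefix_sum N n h.+1.
Proof.
move=> ltn; rewrite {1}/prefix_sum short_sum_rcons => [|p lep]; last first.
  by rewrite prefix_weight_long //; lia.
rewrite {1}/prefix_weight /= !andbF add0r.
(* The factor [t - 1] corrects the weight of a down step that completes a peak. By [up_sum] this
   yields [t - 1] times the sum at [n], [h.+1], which together with the flat step makes [t]. *)
rewrite (@eq_short_sum _ _ (fun p => prefix_weight n h p + prefix_weight n h.+1 p +
  (prefix_weight n.+1 h.+2 p + (t - 1) * up_weight n.+1 h.+2 p))) => [|p].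
  rewrite !short_sumD short_sumZ up_sum // -/(prefix_sum _ _ _).
  by rewrite /prefix_sum; ring.
rewrite big_step prefix_weight_Up prefix_weight_Flat prefix_weight_Down /up_weight /=.
by case: ifP => _; ring.
Qed.

(** A final flat step at height 0 contributes [prefix_sum N n 0], and the down steps excluded for
    completing a level-one peak remove the same amount. This cancellation is the boundary
    condition. *)
Lemma prefix_sum_rec0 N n : (n < N)%N -> prefix_sum N n.+1 0 = prefix_sum N n.+1 1.
Proof.
move=> ltn; rewrite {1}/prefix_sum short_sum_rcons => [|p lep]; last first.
  by rewrite prefix_weight_long //; lia.
rewrite {1}/prefix_weight /= !andbF add0r.
rewrite (@eq_short_sum _ _ (fun p => prefix_weight n 0 p +
  (prefix_weight n.+1 1 p + - 1 * up_weight n.+1 1 p))) => [|p].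
  rewrite !short_sumD short_sumZ up_sum // -/(prefix_sum _ _ _).
  by rewrite /prefix_sum; ring.
rewrite big_step prefix_weight_Up prefix_weight_Flat prefix_weight_Down /up_weight /=.
by case: ifP => _; ring.
Qed.

Lemma prefix_sum0 N h : prefix_sum N 0 h = (h == 0%N)%:R.
Proof.
rewrite /prefix_sum short_sum_rcons => [|p lep]; last first.
  by rewrite prefix_weight_long //; lia.
rewrite /short_sum big1 => [|m _].
  rewrite addr0 /prefix_weight /= add0n eq_sym /schroeder_prefix /= andbT.
  by case: h => [|h]; case: forallP => // -[] i.
apply: big1 => p _; apply: big1 => s _.
by rewrite prefix_weight_long // size_rcons.
Qed.

Lemma prefix_sum_small N n h : (n < h)%N -> prefix_sum N n h = 0.
Proof.
move=> lt; rewrite /prefix_sum /short_sum big1 // => m _; apply: big1 => p _.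
by rewrite /prefix_weight ifF //; apply/negP => /and3P[_]; lia.
Qed.

(** The rows are shifted by one because the boundary condition fails for the empty prefix: in row 0,
    heights 0 and 1 have the sums 1 and 0. *)
Lemma prefix_transfer N :
  transfer 1 t N (fun n d => prefix_sum N.+1 n.+1 d.+1).
Proof.
split=> [d|n d _ ltnd|n d ltn].
- case: d => [|d]; last by rewrite prefix_sum_small.
  rewrite prefix_sum_recS // !prefix_sum0 prefix_sum_small //.
  by rewrite mulr0 addr0 add0r.
- by rewrite prefix_sum_small.
rewrite prefix_sum_recS; last by lia.
rewrite mul1r; congr (_ + _ + _); case: d => //.
by rewrite prefix_sum_rec0 //; lia.
Qed.

End SchroederTransfer.

Lemma sum_Xn_coef (F : fieldType) (T : finType) (P : pred T) (f : T -> nat) k :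
  (\sum_(x | P x) 'X^(f x) : {poly F})`_k = #|[set x | P x && (f x == k)]|%:R.
Proof.
rewrite coef_sum -sum1dep_card natr_sum big_mkcondr; apply: eq_bigr => x _.
by rewrite coefXn eq_sym; case: eqP.
Qed.

Lemma coef_prefix_sum (F : fieldType) n k :
  (prefix_sum ('X : {poly F}) n n 0)`_k = (A126216 n k)%:R.
Proof.
rewrite /prefix_sum /short_sum coef_sum /A126216 natr_sum; apply: eq_bigr => m _.
rewrite /prefix_weight -big_mkcond sum_Xn_coef; congr (_%:R).
apply: eq_card => p; rewrite !inE /is_schroeder_path /schroeder_prefix -!andbA.
rewrite addn0 [count_mem Down _ == _]eq_sym.
case: [forall _, _] => //=; case: (~~ has _ _); rewrite ?andbF //=.
by rewrite andbCA.
Qed.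

(** * Polygon dissections *)

Lemma count_interval a b k :
  count (fun x => a <= x < b)%N (iota 0 k) = (minn b k - a)%N.
Proof.
elim: k => [|k IH]; first by rewrite minn0.
by rewrite -[k.+1]addn1 iotaD count_cat IH /=; lia.
Qed.

Section Rank.
Context {N : nat} (A : {set 'I_N}).

Definition rank (y : nat) : nat := #|[set z in A | (z < y)%N]|.

Lemma mem_below y z : (z \in [set z in A | (z < y)%N]) = (z \in A) && (z < y)%N.
Proof. by rewrite inE. Qed.

Lemma rank_leq x y : (x <= y)%N -> (rank x <= rank y)%N.
Proof.
move=> lexy; apply: subset_leq_card; apply/subsetP => z; rewrite !inE.
by case/andP => -> /leq_trans ->.
Qed.

Lemma rank_ltn (x : 'I_N) y : x \in A -> (x < y)%N -> (rank x < rank y)%N.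
Proof.
move=> Ax lt; apply: proper_card; apply/properP; split.
  by apply/subsetP => z; rewrite !inE => /andP[-> /ltn_trans ->].
by exists x; rewrite !inE ?Ax ?lt ?ltnn.
Qed.

Lemma rank_lt_card (x : 'I_N) : x \in A -> (rank x < #|A|)%N.
Proof.
move=> Ax; apply: proper_card; apply/properP; split.
  by apply/subsetP => z; rewrite inE => /andP[].
by exists x; rewrite // inE ltnn andbF.
Qed.

(** The elements of [A] take each of the ranks 0, ..., [#|A|] - 1 once. This counts the neighbours
    that a cut of the list sends to either side. *)
Lemma card_rank a b : (b <= #|A|)%N ->
  #|[set y in A | (a <= rank y < b)%N]| = (b - a)%N.
Proof.
move=> leb; pose r := [seq rank y | y : 'I_N <- enum A].
have sr : size r = #|A| by rewrite size_map -cardE.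
have Pr : perm_eq r (iota 0 #|A|).
  rewrite -sr; apply: perm_iota => [|x /mapP[y]]; last first.
    by rewrite mem_enum sr => Ay ->; exact: rank_lt_card.
  rewrite map_inj_in_uniq ?enum_uniq // => x y; rewrite !mem_enum => Ax Ay E.
  apply: val_inj; case: (ltngtP x y) => // lt.
    by have := rank_ltn x y Ax lt; rewrite E ltnn.
  by have := rank_ltn y x Ay lt; rewrite E ltnn.
have -> : #|[set y in A | (a <= rank y < b)%N]| = count (fun x => a <= x < b)%N r.
  rewrite count_map cardE /enum_mem size_filter count_filter.
  by apply: eq_count => y; rewrite /= !inE andbC.
by rewrite (permP Pr) count_interval (minn_idPl leb).
Qed.

End Rank.

(* Dissections of the polygon on the vertices 0, ..., n - 1, seen inside an
   ambient vertex set of size N. *)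
Definition diagonal {N} (n : nat) (p : 'I_N * 'I_N) : bool :=
  [&& p.1.+1 < p.2, p.2 < n & ~~ ((p.1 == 0 :> nat) && (p.2.+1 == n))]%N.

Definition dissection {N} (n : nat) (D : {set 'I_N * 'I_N}) : bool :=
  [forall d in D, diagonal n d] && [forall d in D, forall e in D, ~~ crossing d e].

Definition left_nbrs {N} (v : 'I_N) (D : {set 'I_N * 'I_N}) : {set 'I_N} :=
  [set y | (y, v) \in D].

Lemma dissectionP N n (D : {set 'I_N * 'I_N}) :
  reflect ((forall p, p \in D -> diagonal n p) /\
           (forall p q, p \in D -> q \in D -> ~~ crossing p q)) (dissection n D).
Proof.
apply: (iffP andP) => -[/forall_inP H1 H2]; split => //.
- by move=> p q Dp Dq; move/forall_inP: H2 => /(_ _ Dp) /forall_inP /(_ _ Dq).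
- by apply/forall_inP => p Dp; apply/forall_inP => q Dq; apply: H2.
Qed.

Lemma card_last N n (v : 'I_N) (D : {set 'I_N * 'I_N}) :
  v = n :> nat -> (forall p, p \in D -> (p.2 < n.+1)%N) ->
  #|D| = (#|[set p in D | (p.2 < n)%N]| + #|left_nbrs v D|)%N.
Proof.
move=> vn lt; rewrite -(cardsID [set p : 'I_N * 'I_N | (p.2 < n)%N] D).
congr (_ + _)%N; first by apply: eq_card => p; rewrite !inE andbC.
rewrite -[RHS](@card_imset _ _ (fun y => (y, v))); last by move=> x y [].
apply: eq_card => -[x y]; rewrite !inE /=; apply/andP/imsetP => [[ge Dp]|[z]].
  have E : y = v by apply: val_inj; have := lt _ Dp; rewrite /= vn; lia.
  by exists x; rewrite ?inE -E.
by rewrite inE => Dz [-> ->]; rewrite vn ltnn.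
Qed.

(* Merging the last two vertices v = n and v' = n + 1 of an (n + 2)-gon.  The
   neighbours of the merged vertex, listed in increasing order with the two
   sides of the polygon included, are cut by split_last at position d: the lower
   part goes to v', the upper part to v, and e says whether the neighbour at
   position d is kept on both sides. *)
Section MergeSplit.
Context {N n : nat} {v v' : 'I_N}.
Context (n_gt1 : (1 < n)%N) (vn : v = n :> nat) (v'n : v' = n.+1 :> nat).
Implicit Types (D : {set 'I_N * 'I_N}) (d : nat) (e : bool) (x y z : 'I_N).

Definition ext D : {set 'I_N} :=
  [set y : 'I_N | [|| y == 0 :> nat, y.+1 == n | (y, v) \in D]%N].

Definition split_last d e D : {set 'I_N * 'I_N} :=
  [set p : 'I_N * 'I_N |
    if (p.2 < n)%N then p \in D
    else if p.2 == v then
      [&& p.1 \in ext D, d + ~~ e <= rank (ext D) p.1 & p.1.+1 < n]%N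
    else [&& p.2 == v', p.1 \in ext D & 0 < rank (ext D) p.1 <= d]%N].

Definition merge_last D : {set 'I_N * 'I_N} :=
  [set p : 'I_N * 'I_N |
    if (p.2 < n)%N then p \in D
    else [&& p.2 == v, (0 < p.1)%N, (p.1.+1 < n)%N &
             ((p.1, v) \in D) || ((p.1, v') \in D)]].

(** Equivalently, the side joining [v] and [v'] lies on a triangle of the dissection, polygon sides
    counting as edges. Merging its ends identifies the other two edges of the triangle, which costs
    one diagonal. *)
Definition doubled D : bool :=
  [exists y : 'I_N, ((y == 0 :> nat) || ((y, v') \in D)) &&
                    ((y.+1 == n) || ((y, v) \in D))].

Let N_gt : (n.+1 < N)%N.
Proof. by rewrite -v'n. Qed.

Let vv' : (v' == v) = false.
Proof. by apply/eqP => /(congr1 val) /=; rewrite vn v'n; lia. Qed.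

Let zero_lt : (0 < N)%N. Proof. by lia. Qed.
Let pred_lt : (n.-1 < N)%N. Proof. by lia. Qed.
Let v0 : 'I_N := Ordinal zero_lt.
Let v1 : 'I_N := Ordinal pred_lt.

Let v0_ext D : v0 \in ext D. Proof. by rewrite inE. Qed.
Let v1_ext D : v1 \in ext D. Proof. by rewrite inE /= prednK ?eqxx ?orbT //; lia. Qed.

Let rank_v0 D : rank (ext D) 0 = 0%N.
Proof. by apply: eq_card0 => z; rewrite inE andbF. Qed.

Let rank_gt0 D y : (0 < rank (ext D) y)%N = (0 < y)%N.
Proof.
apply/idP/idP => [|y_gt0]; first by have [->|//] := posnP y; rewrite rank_v0.
by rewrite -[X in (X < _)%N](rank_v0 D); exact: (rank_ltn _ v0 _ (v0_ext D)).
Qed.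

Section Split.
Context {D : {set 'I_N * 'I_N}} (DD : dissection n.+1 D).

Let D_lt p : p \in D -> (p.2 < n.+1)%N.
Proof. by have [H _] := dissectionP _ _ _ DD => /H /and3P[]. Qed.

Let nbr_bounds y : (y, v) \in D -> (0 < y)%N && (y.+1 < n)%N.
Proof.
have [H _] := dissectionP _ _ _ DD => /H /and3P[/=]; rewrite vn => -> _.
by rewrite eqxx andbT andbT lt0n.
Qed.

Let ext_lt y : y \in ext D -> (y < n)%N.
Proof. by rewrite inE => /or3P[/eqP->|/eqP<-|/nbr_bounds /andP[_]]; lia. Qed.

Lemma ext_nbr y : y \in ext D -> (0 < y)%N -> (y.+1 < n)%N -> (y, v) \in D.
Proof. by rewrite inE => /or3P[/eqP|/eqP|]//; lia. Qed.

Lemma card_ext : #|ext D| = #|left_nbrs v D|.+2.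
Proof.
rewrite (_ : ext D = v0 |: (v1 |: left_nbrs v D)).
  rewrite !cardsU1 !inE /=; have -> : (v0 == v1) = false.
    by apply/eqP => /(congr1 val) /=; lia.
  case: (boolP (_ \in D)) => [/nbr_bounds|_] //=.
  by case: (boolP (_ \in D)) => [/nbr_bounds|_] //=; lia.
apply/setP => y; rewrite !inE -!val_eqE /=; congr [|| _, _ | _].
by apply/eqP/eqP; lia.
Qed.

Let rank_last y : y.+1 = n -> rank (ext D) y = #|left_nbrs v D|.+1.
Proof.
move=> yn; have Ey : y \in ext D by rewrite inE yn eqxx orbT.
apply/eqP; rewrite -eqSS -card_ext (cardsD1 y (ext D)) Ey add1n eqSS; apply/eqP.
apply: eq_card => z; rewrite !inE -/(z \in ext D).
have := ext_lt z; rewrite !inE; case: [|| _, _ | _] => /=; last by rewrite andbF.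
by rewrite andbT -val_eqE /=; move=> /(_ isT); lia.
Qed.

Context {d : nat} {e : bool} (le_d : (d <= #|left_nbrs v D| + e)%N).

Lemma split_low y : ((y == 0 :> nat) || ((y, v') \in split_last d e D)) =
  (y \in ext D) && (rank (ext D) y <= d)%N.
Proof.
rewrite !inE /= v'n (_ : (n.+1 < n)%N = false) ?vv' ?eqxx /=; last by lia.
rewrite -/(y \in ext D) rank_gt0; have [-> /=|y_gt0] := posnP y.
  by rewrite rank_v0.
by [].
Qed.

Lemma split_high y : ((y.+1 == n) || ((y, v) \in split_last d e D)) =
  (y \in ext D) && (d + ~~ e <= rank (ext D) y)%N.
Proof.
rewrite [_ \in split_last _ _ _]inE /= vn ltnn eqxx.
have [yn /=|ne /=] := eqVneq y.+1 n.
  rewrite rank_last // inE yn eqxx orbT /=.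
  by apply/esym; move: le_d; case: (e) => /=; lia.
have := ext_lt y; case: (y \in ext D) => //= /(_ isT) lt.
by rewrite (_ : (y.+1 < n)%N) ?andbT //; lia.
Qed.

Lemma split_doubled : doubled (split_last d e D) = e.
Proof.
apply/existsP/idP => [[y]|ee].
  rewrite split_low split_high => /andP[/andP[_ le] /andP[_]].
  by case: (e) => //=; lia.
have : (0 < #|[set y in ext D | (d <= rank (ext D) y < d.+1)%N]|)%N.
  by rewrite card_rank ?subSnn // card_ext; move: le_d; rewrite ee; lia.
case/card_gt0P => y; rewrite inE ltnS => /and3P[Ey le1 le2].
by exists y; rewrite split_low split_high Ey le2 ee addn0 le1.
Qed.

Lemma split_merge : merge_last (split_last d e D) = D.
Proof.
apply/setP => -[x y]; rewrite inE /=; case: ltnP => [lt|ge].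
  by rewrite inE /= lt.
have [->|ne] := eqVneq y v; last first.
  apply/esym/negP => /D_lt /= lt; case/eqP: ne; apply: val_inj; rewrite /= vn; lia.
have [x0|x_gt0] := posnP x; first by apply/esym/negP => /nbr_bounds; rewrite x0.
have [lt|ge'] := ltnP x.+1 n; last first.
  by apply/esym/negP => /nbr_bounds /andP[_]; rewrite ltnNge ge'.
have := split_low x; have := split_high x.
rewrite (gtn_eqF x_gt0) (ltn_eqF lt) /= => -> ->.
rewrite -andb_orr [x \in ext D]inE (gtn_eqF x_gt0) (ltn_eqF lt) /=.
by case: ((x, v) \in D) => //=; case: (e) => /=; lia.
Qed.

(** The vertex [n.-1] has the largest rank, so the condition [y.+1 < n] becomes a bound on ranks and
    [card_rank] applies. *)
Lemma mem_split_v y : ((y, v) \in split_last d e D) =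
  (y \in ext D) && (d + ~~ e <= rank (ext D) y < #|left_nbrs v D|.+1)%N.
Proof.
rewrite [LHS]inE /= vn ltnn eqxx; case: (boolP (y \in ext D)) => //= Ey.
congr (_ && _); rewrite -(@rank_last v1); last by rewrite /=; lia.
apply/idP/idP => [lt|]; first by apply: rank_ltn => //=; lia.
by apply: contraTT; rewrite -!leqNgt => ge; apply: rank_leq => /=; lia.
Qed.

Lemma mem_split_v' y : ((y, v') \in split_last d e D) =
  (y \in ext D) && (0 < rank (ext D) y < d.+1)%N.
Proof. by rewrite [LHS]inE /= v'n ltnNge leqnSn vv' eqxx. Qed.

Lemma card_split_v :
  #|left_nbrs v (split_last d e D)| = (#|left_nbrs v D|.+1 - (d + ~~ e))%N.
Proof.
rewrite -(card_rank (ext D)); last by rewrite card_ext.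
by apply: eq_card => y; rewrite inE mem_split_v [RHS]inE.
Qed.

Lemma card_split_v' : #|left_nbrs v' (split_last d e D)| = d.
Proof.
rewrite -[RHS](subn1 d.+1) -(card_rank (ext D)); last first.
  by rewrite card_ext; move: le_d; case: (e); lia.
by apply: eq_card => y; rewrite inE mem_split_v' [RHS]inE.
Qed.

Lemma split_lt p : p \in split_last d e D -> (p.2 < n.+2)%N.
Proof.
rewrite inE; case: ltnP => [lt _|_]; first exact: leq_trans lt (leqW (leqnSn n)).
by case: eqP => [-> _|_ /and3P[/eqP-> _ _]]; rewrite ?vn ?v'n; lia.
Qed.

Lemma card_split : #|split_last d e D| = (#|D| + e)%N.
Proof.
rewrite (card_last _ n.+1 v') // ?card_split_v'; last exact: split_lt.
rewrite (card_last _ n v) // => [|p]; last by rewrite inE => /andP[].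
rewrite (card_last _ n v D) //.
have -> : left_nbrs v [set p in split_last d e D | (p.2 < n.+1)%N] =
          left_nbrs v (split_last d e D).
  by apply/setP => y; rewrite !inE /= vn ltnSn andbT.
rewrite card_split_v (_ : [set p in [set _ in _ | _] | _] = [set p in D | (p.2 < n)%N]).
  by move: le_d; case: (e) => /=; lia.
apply/setP => p; rewrite !inE; case: ltnP => [lt|]; last by rewrite !andbF.
by rewrite ltnS (ltnW lt) !andbT.
Qed.

(** With [v'] replaced by [v], most crossings become crossings of [D]. There remains a chord at [v]
    starting to the left of a chord at [v'], which the ranks exclude: they are at least [d] for [v]
    and at most [d] for [v']. *)
Lemma split_dissection : dissection n.+2 (split_last d e D).
Proof.
have [Dd Dc] := dissectionP _ _ _ DD.
have nbr x y : (x, y) \in split_last d e D -> (n <= y)%N -> (0 < x)%N ->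
    (x.+1 < n)%N -> (x, v) \in D.
  rewrite inE /= => /[swap] le /[swap] x0 /[swap] lt; rewrite ltnNge le /=.
  by case: eqP => [_ /and3P[Ex _ _]|_ /and3P[_ Ex _]]; apply: ext_nbr.
apply/dissectionP; split => [[x y]|[x y] [x' y'] Dp Dq].
  rewrite inE /diagonal /=; case: ltnP => [lt /Dd /and3P[/=]|_]; first by lia.
  case: eqP => [-> /and3P[Ex _ lt]|_ /and3P[/eqP-> Ex]].
    by rewrite vn; lia.
  by rewrite rank_gt0 v'n => /andP[x0 _]; have := ext_lt _ Ex; lia.
apply/negP => /and3P[/= lt1 lt2 lt3].
have [lty|gey] := ltnP y n.
  have Dp' : (x, y) \in D by move: Dp; rewrite inE /= lty.
  have [lty'|gey'] := ltnP y' n.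
    have Dq' : (x', y') \in D by move: Dq; rewrite inE /= lty'.
    by have /negP := Dc _ _ Dp' Dq'; apply; rewrite /crossing /= lt1 lt2.
  have Dq' : (x', v) \in D by apply: nbr Dq _ _ _; lia.
  by have /negP := Dc _ _ Dp' Dq'; apply; rewrite /crossing /= lt1 lt2 vn.
have := split_lt _ Dq; rewrite /= => lty'.
have yv : y = v by apply: val_inj => /=; lia.
have y'v' : y' = v' by apply: val_inj => /=; lia.
move: Dp Dq; rewrite yv y'v' mem_split_v mem_split_v'.
move=> /and3P[Ex le _] /and3P[Ex' _ le'].
by have := rank_ltn _ _ _ Ex lt1; lia.
Qed.

End Split.

Section Merge.
Context {D : {set 'I_N * 'I_N}} (DD : dissection n.+2 D).

Let low y := (y == 0 :> nat) || ((y, v') \in D).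
Let high y := (y.+1 == n) || ((y, v) \in D).
Let d := #|left_nbrs v' D|.

Let Dd p : p \in D -> diagonal n.+2 p.
Proof. by have [H _] := dissectionP _ _ _ DD => /H. Qed.

Let Dc p q : p \in D -> q \in D -> ~~ crossing p q.
Proof. by have [_ H] := dissectionP _ _ _ DD; exact: H. Qed.

Let v_bound y : (y, v) \in D -> (y.+1 < n)%N.
Proof. by move/Dd/and3P => [/=]; rewrite vn. Qed.

Let v'_bound y : (y, v') \in D -> (0 < y < n)%N.
Proof. by move/Dd/and3P => [/=]; rewrite v'n eqxx andbT lt0n ltnS => -> _ ->. Qed.

Lemma merge_dissection : dissection n.+1 (merge_last D).
Proof.
have nbr x y : (x, y) \in merge_last D -> (n <= y)%N -> y = v /\
    exists2 z : 'I_N, (x, z) \in D & (n <= z)%N.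
  rewrite inE /= => /[swap] le; rewrite ltnNge le /=.
  move/and4P => [/eqP -> _ _ /orP[] h]; split => //; first by exists v; rewrite ?vn.
  by exists v'; rewrite ?v'n.
apply/dissectionP; split => [[x y]|[x y] [x' y'] Dp Dq].
  rewrite inE /diagonal /=; case: ltnP => [lt /Dd /and3P[/=]|_]; first by lia.
  by case/and4P => /eqP -> x0 lt _; rewrite vn; lia.
apply/negP => /and3P[/= lt1 lt2 lt3].
have lty : (y < n)%N.
  rewrite ltnNge; apply/negP => ley; have [yv _] := nbr _ _ Dp ley.
  by have [y'v _] := nbr _ _ Dq ltac:(lia); move: lt3; rewrite yv y'v ltnn.
have Dp' : (x, y) \in D by move: Dp; rewrite inE /= lty.
have [lty'|gey'] := ltnP y' n.
  have Dq' : (x', y') \in D by move: Dq; rewrite inE /= lty'.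
  by have /negP := Dc _ _ Dp' Dq'; apply; rewrite /crossing /= lt1 lt2.
have [_ [z Dq' lez]] := nbr _ _ Dq gey'.
by have /negP := Dc _ _ Dp' Dq'; apply; rewrite /crossing /= lt1 lt2 (leq_trans lty).
Qed.

Let ext_merge y : (y \in ext (merge_last D)) = low y || high y.
Proof.
rewrite !inE /= vn ltnn eqxx /= /low /high.
have [//|y0] := eqVneq (y : nat) 0%N.
have [|yn] /= := eqVneq y.+1 n; first by rewrite orbT.
rewrite lt0n y0 /= orbC.
case: (boolP ((y, v') \in D)) => [/v'_bound|_] /=; first by lia.
by case: (boolP ((y, v) \in D)) => [/v_bound ->|]; rewrite ?andbF.
Qed.

(** Otherwise the chords from [y] to [v] and from [x] to [v'] would cross. Hence the neighbours of
    [v'] form an initial segment of the merged list and those of [v] a final one, with at most one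
    vertex in common. *)
Let low_high x y : low x -> high y -> (x <= y)%N.
Proof.
move=> /orP[/eqP->//|Dx] /orP[/eqP yn|Dy].
  by have := v'_bound _ Dx; rewrite -yn; lia.
rewrite leqNgt; apply/negP => lt; have /negP := Dc _ _ Dy Dx; apply.
by rewrite /crossing /= lt vn v'n ltnSn; have /andP[_ ->] := v'_bound _ Dx.
Qed.

Let lows := [set y | low y].

Let card_lows : #|lows| = d.+1.
Proof.
have -> : lows = v0 |: left_nbrs v' D by apply/setP => y; rewrite !inE -val_eqE.
rewrite cardsU1 inE; case: (boolP (_ \in D)) => [/v'_bound|_] //.
Qed.

Let lowsD1_sub y :
  high y -> lows :\ y \subset [set z in ext (merge_last D) | (z < y)%N].
Proof.
move=> hy; apply/subsetP => z; rewrite mem_below ext_merge in_setD1 inE.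
rewrite -val_eqE /= => /andP[ne lz]; rewrite lz /= ltn_neqAle ne /=.
exact: low_high.
Qed.

Let low_rank y :
  low y = (y \in ext (merge_last D)) && (rank (ext (merge_last D)) y <= d)%N.
Proof.
rewrite ext_merge; have [ly|nly] /= := boolP (low y).
  apply/esym; have <- : #|lows :\ y| = d.
    by apply/eqP; rewrite -eqSS -card_lows (cardsD1 y lows) inE ly.
  apply: subset_leq_card; apply/subsetP => z; rewrite mem_below ext_merge in_setD1 inE.
  rewrite -val_eqE /= => /andP[lhz lt]; rewrite (ltn_eqF lt) /=.
  by case/orP: lhz => // hz; have := low_high _ _ ly hz; rewrite leqNgt lt.
case: (boolP (high y)) => //= hy; apply/esym/negbTE; rewrite -ltnNge -card_lows.
have <- : lows :\ y = lows.
  by apply/setP => z; rewrite in_setD1 !inE; case: eqP => // ->; rewrite (negbTE nly).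
exact: subset_leq_card (lowsD1_sub _ hy).
Qed.

Let high_rank y :
  high y = (y \in ext (merge_last D)) &&
           (d + ~~ doubled D <= rank (ext (merge_last D)) y)%N.
Proof.
rewrite ext_merge orbC; have [hy|nhy] /= := boolP (high y).
  apply/esym; apply: leq_trans (subset_leq_card (lowsD1_sub _ hy)).
  have := cardsD1 y lows; rewrite card_lows inE.
  case: (boolP (low y)) => ly; last by case: (doubled D) => /=; lia.
  have -> : doubled D by apply/existsP; exists y; rewrite -/(low y) ly.
  by rewrite /=; lia.
apply/esym/andP => -[ly]; move: (ly); rewrite low_rank => /andP[Ey le].
case: (boolP (doubled D)) => [/existsP[x /andP[lx hx]] /=|_ /=]; last by lia.
have lt : (y < x)%N.
  rewrite ltn_neqAle (low_high _ _ ly hx) andbT.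
  by apply: contraNneq nhy => /val_inj ->.
have := rank_ltn _ _ _ Ey lt; move: lx; rewrite -/(low x) low_rank => /andP[_]; lia.
Qed.

Lemma merge_split : split_last d (doubled D) (merge_last D) = D.
Proof.
apply/setP => -[x y]; rewrite inE /=; case: ltnP => [lt|ge]; first by rewrite inE /= lt.
case: eqP => [->|ne].
  rewrite andbA -high_rank /high; have [E|_] /= := eqVneq x.+1 n.
    by rewrite E ltnn; apply/esym/negP => /v_bound; rewrite E ltnn.
  by case: (boolP (_ \in D)) => // /v_bound.
have [->|ne'] := eqVneq y v'; last first.
  apply/esym/negP => /Dd /and3P[_ /= lt _]; case/eqP: ne'; apply: val_inj => /=.
  by rewrite v'n; apply/eqP; rewrite eqn_leq -ltnS lt ltn_neqAle ge -vn andbT;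
    apply/eqP => /val_inj E; case: ne.
rewrite ?eqxx /= andbCA -low_rank rank_gt0 /low /=; case: posnP => [x0|_] /=.
  by apply/esym/negP => /v'_bound; rewrite x0.
by [].
Qed.

(** The [d.+1] vertices of [lows] are among the merged neighbours, sides included. Without a doubled
    vertex they omit [n.-1], which always borders [v], and the bound drops by one. *)
Lemma merge_degree : (d <= #|left_nbrs v (merge_last D)| + doubled D)%N.
Proof.
have sub : lows \subset ext (merge_last D).
  by apply/subsetP => y; rewrite inE ext_merge => ->.
have cE := card_ext merge_dissection.
have [_|nd] := boolP (doubled D).
  by have := subset_leq_card sub; rewrite cE card_lows; lia.
have h1 : high v1 by rewrite /high /= prednK ?eqxx //; lia.
have : lows \subset ext (merge_last D) :\ v1.
  rewrite subsetD1 sub inE; apply: contra nd => l1.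
  by apply/existsP; exists v1; rewrite -/(low v1) l1.
move/subset_leq_card; rewrite card_lows.
have := cardsD1 v1 (ext (merge_last D)); rewrite v1_ext cE add1n => -[<-].
by rewrite addn0.
Qed.

End Merge.
End MergeSplit.

Section DissectionTransfer.
Context {R : comNzRingType} (t : R).

Definition degree {N} (m : nat) (D : {set 'I_N * 'I_N}) : nat :=
  #|[set p in D | p.2 == m :> nat]|.

Definition dissection_sum N (l d : nat) : R :=
  \sum_(D : {set 'I_N * 'I_N} | dissection l.+3 D && (d <= degree l.+2 D)%N)
    t ^+ #|D|.

Lemma degreeE N m (v : 'I_N) (D : {set 'I_N * 'I_N}) :
  v = m :> nat -> degree m D = #|left_nbrs v D|.
Proof.
move=> vm; rewrite -[RHS](@card_imset _ _ (fun y => (y, v))); last by move=> x y [].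
apply: eq_card => -[x y]; rewrite !inE /= -vm.
apply/andP/imsetP => [[Dp /eqP/val_inj E]|[z]].
  by exists x; rewrite ?inE -E.
by rewrite inE => Dz [-> ->].
Qed.

Lemma split_sum N n (v v' : 'I_N) (d : nat) (e : bool) :
  (1 < n)%N -> v = n :> nat -> v' = n.+1 :> nat ->
  \sum_(D : {set 'I_N * 'I_N} |
      dissection n.+2 D && (#|left_nbrs v' D| == d) &&
      (@doubled N n v v' D == e))
    t ^+ #|D| =
  \sum_(D : {set 'I_N * 'I_N} |
      dissection n.+1 D && (d <= #|left_nbrs v D| + e)%N) t ^+ (#|D| + e).
Proof.
move=> n1 vn v'n.
rewrite (reindex_onto (@split_last N n v v' d e)
                      (@merge_last N n v v')) /=.
  have E (D : {set 'I_N * 'I_N}) :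
    dissection n.+2 (@split_last N n v v' d e D) &&
        (#|left_nbrs v' (@split_last N n v v' d e D)| == d)
      && (@doubled N n v v' (@split_last N n v v' d e D) == e)
     && (@merge_last N n v v' (@split_last N n v v' d e D) == D) =
    dissection n.+1 D && (d <= #|left_nbrs v D| + e)%N.
    apply/idP/idP => [/andP[/andP[/andP[DD /eqP dE] /eqP eE] /eqP E]|/andP[DD le]].
      have := merge_dissection n1 vn v'n DD; have := merge_degree n1 vn v'n DD.
      by rewrite E dE eE => -> ->.
    rewrite split_dissection // card_split_v' // split_doubled // split_merge //.
    by rewrite !eqxx.
  rewrite (eq_bigl _ _ E).
  by apply: eq_bigr => D /andP[DD le]; rewrite card_split.
move=> D /andP[/andP[DD /eqP <-] /eqP <-]; exact: merge_split.
Qed.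

Lemma dissection_transfer M : transfer t 1 M (dissection_sum M.+3).
Proof.
split=> [d|n d lenM ltnd|l d ltl].
- rewrite /dissection_sum (eq_bigl (fun D => (D == set0) && (d == 0%N))).
    case: d => [|d]; last by rewrite big_pred0 // => D; rewrite andbF.
    by rewrite (big_pred1 set0) ?cards0 // => D; rewrite andbT.
  move=> D; apply/andP/andP => [[DD]|[/eqP -> /eqP ->]].
    have D0 : D = set0.
      apply/setP => -[x y]; rewrite inE; apply/negP => Dp.
      by have [H _] := dissectionP _ _ _ DD; have /and3P[/=] := H _ Dp; lia.
    rewrite D0 (_ : degree _ _ = 0%N) ?leqn0 ?eqxx //.
    by apply: eq_card0 => p; rewrite !inE.
  by split=> //; apply/dissectionP; split=> p; rewrite inE.
- rewrite /dissection_sum big_pred0 // => D; apply/negP => /andP[DD].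
  have [H _] := dissectionP _ _ _ DD.
  have lv : (n.+2 < M.+3)%N by lia.
  rewrite (degreeE _ _ (Ordinal lv)) // leqNgt => /negP; apply.
  have sub : left_nbrs (Ordinal lv) D \subset [set i : 'I_M.+3 | 1 <= i < n.+1]%N.
    by apply/subsetP => y; rewrite !inE => /H /and3P[/=]; rewrite eqxx andbT; lia.
  have := subset_leq_card sub.
  by rewrite (card_ord_count _ (fun i => 1 <= i < n.+1)%N) count_interval; lia.
have lv : (l.+2 < M.+3)%N by lia.
have lv' : (l.+3 < M.+3)%N by lia.
pose v := Ordinal lv; pose v' := Ordinal lv'.
pose dbl := @doubled M.+3 l.+2 v v'.
have S e := split_sum M.+3 l.+2 v v' d e isT erefl erefl.
have deg' D : degree l.+3 D = #|left_nbrs v' D| by exact: degreeE.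
have deg D : degree l.+2 D = #|left_nbrs v D| by exact: degreeE.
(* The larger degrees give column [d.+1]. Degree exactly [d] is split by [dbl]: merging the last two
   vertices yields column [d.-1] with a factor [t], or column [d]. *)
rewrite {1}/dissection_sum (bigID (fun D => degree l.+3 D == d)) /= addrC -addrA.
congr (_ + _).
  apply: eq_bigl => D; rewrite -andbA; congr (_ && _).
  by rewrite [RHS]ltn_neqAle eq_sym andbC.
rewrite (bigID dbl) /=; congr (_ + _).
  rewrite (eq_bigl (fun D => dissection l.+4 D &&
    (#|left_nbrs v' D| == d) && (dbl D == true))).
    rewrite S mulr_sumr; apply: eq_big => [D|D _]; last by rewrite addn1 exprS.
    (* At [d = 0] both bounds on the degree are vacuous, as the boundary condition requires. *)
    by rewrite deg addn1; case: (d) => [|d'] /=; rewrite ?leq0n.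
  move=> D; rewrite deg' eqb_id -!andbA; congr (_ && _).
  by case: eqP => [->|]; rewrite ?leqnn ?andbF.
rewrite (eq_bigl (fun D => dissection l.+4 D &&
    (#|left_nbrs v' D| == d) && (dbl D == false))).
  rewrite S mul1r; apply: eq_big => [D|D _]; last by rewrite addn0.
  by rewrite deg addn0.
move=> D; rewrite deg' eqbF_neg -!andbA; congr (_ && _).
by case: eqP => [->|]; rewrite ?leqnn ?andbF.
Qed.

End DissectionTransfer.

Lemma coef_dissection_sum (F : fieldType) l k :
  (dissection_sum ('X : {poly F}) l.+3 l 0)`_k = (A033282 l.+3 k)%:R.
Proof.
rewrite /dissection_sum sum_Xn_coef; congr (_%:R); apply: eq_card => D.
rewrite !inE andbT /dissection /is_dissection; congr (_ && _ && _).
apply: eq_forallb_in => -[x y] _.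
by rewrite /diagonal /is_diagonal ltn_ord.
Qed.

(** * Zeros *)

Section ThreeTerm.
Context {F : numFieldType}.

Lemma coef_V_fact n k :
  (V F n)`_k = (n ^_ k)%:R * (n + k + 2)`!%:R / (n.+2`!%:R * k`!%:R * k.+1`!%:R).
Proof.
have fn m := @fact_neq0 F m.
have -> : (n ^_ k)%:R = 'C(n, k)%:R * k`!%:R :> F by rewrite -natrM bin_ffact.
have -> : (n + k + 2)`!%:R = 'C(n + k + 2, k)%:R * (k`!%:R * n.+2`!%:R) :> F.
  rewrite -!natrM -(@bin_fact (n + k + 2) k); last by lia.
  by rewrite (_ : n + k + 2 - k = n.+2)%N; last by lia.
rewrite coef_V [k.+1`!]factS natrM.
have k1 : k.+1%:R != 0 :> F by rewrite pnatr_eq0.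
by field; rewrite !fn nat1r k1.
Qed.

(** The difference is taken in the field; for [k > n] the falling factorial already vanishes, so
    coefficients beyond the degree need no separate case in the recurrence. *)
Lemma ffactnSr_field n k : (n ^_ k.+1)%:R = (n ^_ k)%:R * (n%:R - k%:R) :> F.
Proof.
rewrite ffactnSr natrM; have [le|lt] := leqP k n; first by rewrite natrB.
by rewrite ffact_small // !mul0r.
Qed.

(** This is the Gegenbauer recurrence of parameter 3/2 in the variable 1 + 2t, normalized to the
    value 1 at t = 0. It is verified on coefficients; from degree two on, each reduces to a rational
    multiple of [f * T / (Z * K * K)]. *)
Lemma V_three_term n :
  n.+4%:R *: V F n.+2 =
  (2 * n%:R + 5) *: ((1 + 2%:R *: 'X) * V F n.+1) - n.+1%:R *: V F n.
Proof.
have nS m : m.+1%:R = m%:R + 1 :> F by rewrite -natr1.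
apply/polyP => k.
rewrite coefB !coefZ [(1 + _) * _]mulrDl mul1r coefD -scalerAl coefZ coefXM.
case: k => [|[|i]].
- rewrite !coef_V !bin0 !invr1 !mulr1 /= mulr0 addr0 mulr1.
  by rewrite (nS n.+3) (nS n.+2) (nS n.+1) (nS n); ring.
- rewrite !coef_V !bin0 !bin1 (nS n.+3) (nS n.+2) (nS n.+1) (nS n) !natrD.
  rewrite (nS n.+1) (nS n).
  rewrite /= invr1 !mulr1; by field.
rewrite !coef_V_fact.
set f : F := (n ^_ i)%:R; set T : F := (n + i.+2 + 2)`!%:R.
set Z : F := n.+2`!%:R; set K : F := i.+1`!%:R.
have [Z0 K0] : Z != 0 /\ K != 0 by rewrite !fact_neq0.
have i2 : i%:R + 2 != 0 :> F by rewrite -natrD pnatr_eq0 addn2.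
have i3 : i%:R + 3 != 0 :> F by rewrite -natrD pnatr_eq0 addn3.
have n3 : n%:R + 3 != 0 :> F by rewrite -natrD pnatr_eq0 addn3.
have n4 : n%:R + 4 != 0 :> F by rewrite -natrD pnatr_eq0 addnS.
have E1 : (n.+2 ^_ i.+2)%:R = (n%:R + 2) * (n%:R + 1) * f :> F.
  by rewrite !ffactSS !natrM (nS n.+1) (nS n) -/f; ring.
have E2 : (n.+1 ^_ i.+2)%:R = (n%:R + 1) * f * (n%:R - i%:R) :> F.
  by rewrite ffactSS natrM ffactnSr_field (nS n) -/f; ring.
have E3 : (n.+1 ^_ i.+1)%:R = (n%:R + 1) * f :> F.
  by rewrite ffactSS natrM (nS n).
have E4 : (n ^_ i.+2)%:R = f * (n%:R - i%:R) * (n%:R - i%:R - 1) :> F.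
  by rewrite !ffactnSr_field -/f (nS i); ring.
have T1 : (n.+1 + i.+2 + 2)`!%:R = (n%:R + i%:R + 5) * T.
  rewrite (_ : n.+1 + i.+2 + 2 = (n + i.+2 + 2).+1)%N; last by lia.
  rewrite factS natrM -/T; congr (_ * _); rewrite -!natrD; congr (_%:R); lia.
have T2 : (n.+2 + i.+2 + 2)`!%:R = (n%:R + i%:R + 6) * ((n%:R + i%:R + 5) * T).
  rewrite -T1 (_ : n.+2 + i.+2 + 2 = (n.+1 + i.+2 + 2).+1)%N; last by lia.
  rewrite factS natrM; congr (_ * _); rewrite -!natrD; congr (_%:R); lia.
have T3 : (n.+1 + i.+1 + 2)`!%:R = T.
  by rewrite (_ : n.+1 + i.+1 + 2 = n + i.+2 + 2)%N //; lia.
have Z3 : n.+3`!%:R = (n%:R + 3) * Z.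
  by rewrite factS natrM -/Z -natrD addn3.
have Z4 : n.+4`!%:R = (n%:R + 4) * ((n%:R + 3) * Z).
  by rewrite factS natrM Z3 -(addn4 n) natrD.
have K2 : i.+2`!%:R = (i%:R + 2) * K by rewrite factS natrM -/K -natrD addn2.
have K3 : i.+3`!%:R = (i%:R + 3) * ((i%:R + 2) * K).
  by rewrite factS natrM K2 -(addn3 i) natrD.
rewrite E1 E2 E3 E4 T1 T2 T3 Z3 Z4 K2 K3 -/T -/Z -/K.
rewrite (_ : n.+4%:R = n%:R + 4 :> F); last by rewrite -natrD addn4.
rewrite (nS n).
simpl (if _ then _ else _).
by field; rewrite n3 n4 i2 i3 Z0 K0.
Qed.

Lemma V_at0 n : (V F n).[0] = 1.
Proof. by rewrite horner_coef0 coef_V !bin0 invr1 !mulr1. Qed.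

Lemma V0 : V F 0 = 1.
Proof. by rewrite /V big_ord1 expr0 !bin0 invr1 !mulr1 scale1r. Qed.

Lemma V1 : V F 1 = 1 + 2%:R *: 'X.
Proof.
rewrite /V big_ord_recl big_ord1 /= !bin0 bin1 expr0 invr1 !mulr1 scale1r.
rewrite (_ : 'C(1 + bump 0 0 + 2, bump 0 0) = 4) // /bump /=; congr (_ + _ *: _).
by field.
Qed.

Lemma V_atN1 n : (V F n).[-1] = (-1) ^+ n.
Proof.
suff: (V F n).[-1] = (-1) ^+ n /\ (V F n.+1).[-1] = (-1) ^+ n.+1 by case.
elim: n => [|n [IH1 IH2]].
  by rewrite V0 V1 !hornerE; split=> //; ring.
split => //; have n4 : n.+4%:R != 0 :> F by rewrite pnatr_eq0.
apply: (mulfI n4); have /(congr1 (horner^~ (-1))) := V_three_term n.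
rewrite hornerD hornerN !hornerZ hornerM hornerD hornerZ hornerX hornerC IH1 IH2 => ->.
by rewrite !exprS -!natr1; ring.
Qed.

End ThreeTerm.

Section Interlacing.
Context {R : realType}.
Implicit Types (p q : {poly R}) (a b : seq R).

Lemma ivt_open p (x y : R) : x < y -> p.[x] * p.[y] < 0 ->
  exists2 z, x < z < y & root p z.
Proof.
move=> lt neg.
have wlog q : q.[x] < 0 -> 0 < q.[y] -> exists2 z, x < z < y & root q z.
  move=> qx qy; have [|z /andP[xz zy] rz] := @poly_ivt R q x y (ltW lt).
    by rewrite !ltW.
  exists z => //; rewrite !lt_neqAle xz zy !andbT; apply/andP; split.
    by apply: contraTneq rz => <-; rewrite /root ltr0_neq0.
  by apply: contraTneq rz => ->; rewrite /root lt0r_neq0.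
have [px|px|px] := ltgtP p.[x] 0.
- by apply: wlog => //; move: neg; rewrite nmulr_rlt0.
- have [||z lz rz] := wlog (- p); rewrite ?hornerN ?oppr_lt0 ?oppr_gt0 //.
    by move: neg; rewrite pmulr_rlt0.
  by exists z => //; rewrite -rootN.
- by move: neg; rewrite px mul0r ltxx.
Qed.

Lemma zeros_of_roots p a : p != 0 -> size p = (size a).+1 ->
  sorted <%R a -> all (root p) a -> simple_real_zeros p a.
Proof.
move=> p0 sp sa ra; split=> //; apply: all_roots_prod_XsubC => //.
by rewrite uniq_rootsE (sorted_uniq lt_trans (@ltxx _ _)).
Qed.

Lemma size_zeros p a : simple_real_zeros p a -> size p = (size a).+1.
Proof.
by move=> [p0 _ ->]; rewrite size_scale ?lead_coef_eq0 // size_prod_XsubC.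
Qed.

Lemma root_zeros p a x : simple_real_zeros p a -> x \in a -> root p x.
Proof. by move=> [p0 _ ->] xa; rewrite rootZ ?lead_coef_eq0 // root_prod_XsubC. Qed.

(** Each of the [size a - i] zeros above [x] contributes a negative factor, each zero below a
    positive one. *)
Lemma sign_zeros p a i (x : R) :
  simple_real_zeros p a -> 0 < lead_coef p -> (i <= size a)%N ->
  (forall j, (j < i)%N -> a`_j < x) ->
  (forall j, (i <= j < size a)%N -> x < a`_j) ->
  0 < (-1) ^+ (size a - i) * p.[x].
Proof.
move=> [p0 _ ->] lp lei lo hi; rewrite hornerZ mulrCA pmulr_rgt0; last first.
  by rewrite lead_coefZ lead_coef_prod_XsubC mulr1 in lp *.
rewrite horner_prod -(cat_take_drop i a) big_cat /= mulrCA.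
have -> : (size (take i a ++ drop i a) - i = size (drop i a))%N.
  by rewrite cat_take_drop size_drop.
apply: mulr_gt0.
  rewrite big_seq; apply: prodr_gt0 => y /(nthP 0)[j].
  rewrite size_takel // => lj <-; rewrite nth_take // hornerXsubC subr_gt0.
  exact: lo.
have {hi} : all (fun y => x < y) (drop i a).
  apply/(all_nthP 0) => j; rewrite size_drop nth_drop => lj.
  by apply: hi; rewrite leq_addr -ltn_subRL.
elim: (drop i a) => [|y s IH] /=; first by rewrite big_nil expr0 mulr1.
case/andP=> xy /IH pos; rewrite big_cons exprS hornerXsubC.
rewrite mulrACA mulN1r opprB mulr_gt0 // subr_gt0 //.
Qed.

Definition interlace_in a b : Prop :=
  size b = (size a).+1 /\
  forall i, (i < size a)%N -> b`_i < a`_i /\ a`_i < b`_i.+1.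

(** At a zero of [q] the sign of [r] is opposite to that of [p], which the interlacing of [a] and
    [b] determines. With the two endpoints this gives [size b + 1] disjoint intervals containing a
    zero, as many as the degree of [r]. *)
Lemma interlace_step p q (r : {poly R}) a b :
  simple_real_zeros p a -> simple_real_zeros q b -> interlace_in a b ->
  0 < lead_coef p -> size r = (size b).+2 ->
  all (fun x => -1 < x < 0) b ->
  (forall x, x \in b -> exists2 C : R, 0 < C & r.[x] = - C * p.[x]) ->
  0 < (-1) ^+ (size b).+1 * r.[-1] -> 0 < r.[0] ->
  exists e, [/\ simple_real_zeros r e, interlace_in b e
              & all (fun x => -1 < x < 0) e].
Proof.
move=> Zp Zq [sb ab] lp sr bin rb r1 r0.
have srt_b : sorted <%R b by case: Zq.
pose s := -1 :: rcons b 0.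
have ss : size s = (size b).+2 by rewrite /= size_rcons.
have s0 : s`_0 = -1 by [].
have sS i : (i < size b)%N -> s`_i.+1 = b`_i by move=> lti; rewrite /= nth_rcons lti.
have sl : s`_(size b).+1 = 0 by rewrite /= nth_rcons ltnn eqxx.
have srt : sorted <%R s.
  rewrite /= rcons_path; apply/andP; split.
    rewrite (path_sortedE lt_trans) srt_b andbT.
    by apply: sub_all bin => x /andP[].
  case/lastP: (b) bin => [|b' x]; rewrite ?ltrN10 //.
  by rewrite all_rcons last_rcons => /andP[/andP[]].
have s_lt i : (i < (size b).+1)%N -> s`_i < s`_i.+1.
  by move=> lti; move/(sortedP 0): srt; apply; rewrite ss.
have s_le i j : (i <= j)%N -> (j < (size b).+2)%N -> s`_i <= s`_j.
  move=> leij ltj; rewrite (lt_sorted_leq_nth 0 srt) // inE ss //.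
  exact: leq_ltn_trans ltj.
have b_le i j : (i <= j)%N -> (j < size b)%N -> b`_i <= b`_j.
  move=> leij ltj; rewrite (lt_sorted_leq_nth 0 srt_b) // inE //.
  exact: leq_ltn_trans ltj.
have s_sign i : (i < (size b).+2)%N -> 0 < (-1) ^+ ((size b).+1 - i) * r.[s`_i].
  case: i => [_|i]; first by rewrite subn0.
  rewrite ltnS leq_eqVlt eqSS subSS => /orP[/eqP->|lti].
    by rewrite sl subnn expr0 mul1r.
  rewrite ltnS in lti; rewrite sS //.
  have [C C0 ->] := rb _ (mem_nth 0 lti).
  have lei : (i <= size a)%N by rewrite -ltnS -sb.
  suff pos : 0 < (-1) ^+ (size a - i) * p.[b`_i].
    rewrite sb subSn // exprS (_ : _ * _ = C * ((-1) ^+ (size a - i) * p.[b`_i])).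
      exact: mulr_gt0.
    by ring.
  (* Exactly the first [i] zeros of [p] lie below the zero number [i] of [q], counted from 0. *)
  apply: sign_zeros => // j.
    move=> ltj; have ltja := leq_trans ltj lei.
    by have [_ lt] := ab _ ltja; apply: lt_le_trans lt (b_le _ _ ltj lti).
  case/andP=> leij ltj; have [lt _] := ab _ ltj; apply: le_lt_trans lt.
  by apply: b_le => //; rewrite sb ltnW.
have ex (i : 'I_(size b).+1) : exists z, (s`_i < z < s`_i.+1) && root r z.
  have [|z lz rz] := ivt_open r _ _ (s_lt _ (ltn_ord i)); last by exists z; rewrite lz.
  have := s_sign _ (ltnW (ltn_ord i)); have := s_sign i.+1 (ltn_ord i).
  rewrite subSS subSn ?exprS; last by rewrite -ltnS.
  (* Consecutive points carry opposite signs [m] and [- m]; since [m ^+ 2 = 1], the product of the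
     two sign conditions is the hypothesis of [ivt_open]. *)
  have := sqrr_sign R (size b - i).
  move: ((-1) ^+ (size b - i)) (r.[_]) (r.[_]) => m u w m2 mu mw.
  have := mulr_gt0 mu mw; rewrite (_ : _ * _ = - (m ^+ 2 * (w * u))); last by ring.
  by rewrite m2 mul1r oppr_gt0 mulrC.
have [f fP] := fin_all_exists ex.
pose e := mkseq (fun i => f (inord i)) (size b).+1.
have eP i : (i < (size b).+1)%N -> (s`_i < e`_i < s`_i.+1) && root r e`_i.
  by move=> lti; have := fP (inord i); rewrite nth_mkseq // inordK.
have se : size e = (size b).+1 by rewrite size_mkseq.
exists e; split.
- apply: zeros_of_roots; first by apply: contraTneq r0 => ->; rewrite horner0 ltxx.
  + by rewrite sr se.
  + apply/(sortedP 0) => i; rewrite se => lti.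
    have /andP[/andP[_ lt1] _] := eP i (ltnW lti).
    by have /andP[/andP[lt2 _] _] := eP i.+1 lti; apply: lt_trans lt2.
  + by apply/(all_nthP 0) => i; rewrite se => /eP /andP[].
- split=> // i lti; rewrite -sS //.
  have /andP[/andP[_ lt1] _] := eP i (leqW lti).
  by have /andP[/andP[lt2 _] _] := eP i.+1 lti.
- apply/(all_nthP 0) => i; rewrite se => lti; have /andP[/andP[lt1 lt2] _] := eP i lti.
  rewrite -s0 (le_lt_trans (s_le _ _ (leq0n i) (leqW lti)) lt1) /=.
  by apply: (lt_le_trans lt2); rewrite -[leRHS]sl; exact: s_le.
Qed.

End Interlacing.

Section VZeros.
Context {R : realType}.

Lemma lead_coef_V_gt0 n : 0 < lead_coef (V R n).
Proof. by rewrite lead_coefE size_V coef_V_gt0. Qed.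

(** The zeros are kept between -1 and 0, not merely negative, because -1 is the left endpoint in the
    next step. Two consecutive polynomials are carried along for the three-term recurrence. *)
Lemma V_zeros n : exists a b : seq R,
  [/\ simple_real_zeros (V R n) a, simple_real_zeros (V R n.+1) b,
      interlace_in a b, all (fun x => -1 < x < 0) a & all (fun x => -1 < x < 0) b].
Proof.
elim: n => [|n [a [b [Za Zb ab ain bin]]]].
  have V1N : V R 1 != 0 by rewrite -size_poly_eq0 size_V.
  exists [::], [:: - 2^-1]; split=> //.
  - by apply: zeros_of_roots; rewrite ?size_V // -size_poly_eq0 size_V.
  - apply: zeros_of_roots; rewrite ?size_V //= andbT V1 /root !hornerE.
    by rewrite mulrN divff ?subrr // pnatr_eq0.
  - by rewrite /= andbT; lra.
have sb : size b = n.+1 by have := size_zeros _ _ Zb; rewrite size_V => -[].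
have n4 : n.+4%:R != 0 :> R by rewrite pnatr_eq0.
have [|||x xb||| e [Ze be ein]] := @interlace_step R _ _ (V R n.+2) _ _ Za Zb ab.
- exact: lead_coef_V_gt0.
- by rewrite size_V sb.
- exact: bin.
(* At a zero of [V R n.+1] the middle term of the recurrence vanishes, which leaves the ratio of the
   outer coefficients. *)
- exists (n.+1%:R / n.+4%:R); first by rewrite divr_gt0 ?ltr0n.
  apply: (mulfI n4); have /(congr1 (horner^~ x)) := V_three_term (F := R) n.
  have /eqP Vx := root_zeros _ _ _ Zb xb.
  rewrite hornerD hornerN !hornerZ hornerM Vx mulr0 mulr0 sub0r => ->.
  by rewrite mulNr mulrN mulrA [_ * (_ / _)]mulrC divfK.
- by rewrite V_atN1 sb -exprMn mulrN1 opprK expr1n ltr01.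
- by rewrite V_at0 ltr01.
by exists b, e.
Qed.

Lemma root_reciprocal n (x : R) : x != 0 -> root (V R n) x ->
  root (reciprocal n (V R n)) x^-1.
Proof.
move=> x0 /eqP Vx; rewrite /root horner_reciprocal ?size_V ?invr_eq0 //.
by rewrite invrK Vx mulr0.
Qed.

(** Inversion is decreasing on the negative reals, hence the reversed list. The degree stays [n]
    because the constant coefficient of [V R n] is nonzero. *)
Lemma reciprocal_zeros n a : simple_real_zeros (V R n) a -> all (fun x => x < 0) a ->
  simple_real_zeros (reciprocal n (V R n)) (rev [seq x^-1 | x <- a]).
Proof.
move=> Za neg; have [_ srt _] := Za.
have sa : size a = n by have := size_zeros _ _ Za; rewrite size_V => -[].
apply: zeros_of_roots.
- by rewrite -size_poly_eq0 size_reciprocal_V.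
- by rewrite size_reciprocal_V size_rev size_map sa.
- rewrite rev_sorted sorted_map.
  apply: (sub_in_sorted (P := fun x => x < 0)) srt => // x y x0 y0.
  by rewrite /relpre /= ltf_nV2.
- rewrite all_rev all_map; apply/allP => x xa /=.
  have x0 := allP neg _ xa; apply: root_reciprocal; first by rewrite ltr0_neq0.
  exact: root_zeros Za xa.
Qed.

Lemma all_neg_inv (a : seq R) : all (fun x => x < 0) a ->
  all (fun x => x < 0) (rev [seq x^-1 | x <- a]).
Proof.
move=> /allP neg; rewrite all_rev all_map; apply/allP => x /neg /= x0.
by rewrite invr_lt0.
Qed.

(** The interlacing pattern is symmetric under reversal of the order, so a decreasing map preserves
    it. *)
Lemma interlace_inv (a b : seq R) :
  all (fun x => x < 0) a -> all (fun x => x < 0) b -> interlace_in a b ->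
  interlace_in (rev [seq x^-1 | x <- a]) (rev [seq x^-1 | x <- b]).
Proof.
move=> /all_nthP na /all_nthP nb [sb ab]; split.
  by rewrite !size_rev !size_map sb.
move=> i; rewrite size_rev size_map => lti.
have aux m : (i < m)%N ->
    [/\ m - i.+1 < m, m - i.+1 < m.+1, m - i < m.+1 & (m - i.+1).+1 = m - i]%N.
  by move=> lt; split; lia.
have [lt1 lt2 lt3 E] := aux _ lti.
rewrite !nth_rev ?size_map ?sb // ?leqW // subSS !(nth_map 0) ?sb //.
have [] := ab _ lt1; rewrite E.
have := na 0 _ lt1; have := nb 0 (size a - i)%N; have := nb 0 (size a - i.+1)%N.
by rewrite sb => /(_ lt2) ? /(_ lt3) ? ?; rewrite !ltf_nV2.
Qed.

Lemma V_real_rooted n : (1 <= n)%N ->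
  [/\ simple_negative_zeros (V R n.-1),
      simple_negative_zeros (reciprocal n.-1 (V R n.-1)),
      strictly_interlace (V R n.-1) (V R n)
    & strictly_interlace (reciprocal n.-1 (V R n.-1)) (reciprocal n (V R n))].
Proof.
case: n => // n _ /=; have [a [b [Za Zb ab ain bin]]] := V_zeros n.
have neg (s : seq R) : all (fun x => -1 < x < 0) s -> all (fun x => x < 0) s.
  by apply: sub_all => x /andP[].
have na := neg _ ain; have nb := neg _ bin.
have Zra := reciprocal_zeros _ _ Za na; have Zrb := reciprocal_zeros _ _ Zb nb.
have [sr rab] := interlace_inv _ _ na nb ab.
split; [by exists a| | |].
- by exists (rev [seq x^-1 | x <- a]) => //; exact: all_neg_inv.
- by exists a, b; split=> //; case: ab.
- by exists (rev [seq x^-1 | x <- a]), (rev [seq x^-1 | x <- b]); split.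
Qed.

End VZeros.

(** * Identification of the generating polynomials and of the OEIS rows *)

Section Rows.
Context {F : numFieldType}.

Lemma asc_poly_V n Pi : Pi \in pattern_pairs -> asc_poly F n.+1 Pi = V F n.
Proof.
move=> HPi; rewrite -kirkman_sum_V.
have T := code_transfer ('X : {poly F}) 1 n.
rewrite -(transfer_unique _ _ n _ _ T (kirkman_transfer _ _ n)) //.
rewrite -(parking_sum_code _ _ n _ HPi); apply: eq_bigr => w _.
by rewrite expr1n mulr1.
Qed.

Lemma des_poly_V n Pi : Pi \in pattern_pairs ->
  des_poly F n.+1 Pi = reciprocal n (V F n).
Proof.
move=> HPi; rewrite -kirkman_sum_reciprocal.
have T := code_transfer (1 : {poly F}) 'X n.
rewrite -(transfer_unique _ _ n _ _ T (kirkman_transfer _ _ n)) //.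
rewrite -(parking_sum_code _ _ n _ HPi); apply: eq_bigr => w _.
by rewrite expr1n mul1r.
Qed.

Lemma V_A033282 n : V F n = [seq c%:R | c <- A033282_row (n.+1 + 2)] :> seq F.
Proof.
apply: (@eq_from_nth _ 0); rewrite size_V.
  by rewrite size_map size_mkseq; lia.
move=> k ltk; rewrite (nth_map 0%N) ?nth_mkseq ?size_mkseq; [|lia|lia].
rewrite addn2 -coef_dissection_sum -kirkman_sum_V.
have T := dissection_transfer ('X : {poly F}) n.
by rewrite (transfer_unique _ _ n _ _ (kirkman_transfer 'X 1 n) T).
Qed.

Lemma reciprocal_A126216 n :
  reciprocal n (V F n) = [seq c%:R | c <- A126216_row n.+1] :> seq F.
Proof.
apply: (@eq_from_nth _ 0); rewrite size_reciprocal_V.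
  by rewrite size_map size_mkseq.
move=> k ltk; rewrite (nth_map 0%N) ?nth_mkseq ?size_mkseq //.
(* Complete paths end at height 0; the boundary condition moves them to height 1, which is column 0
   of [prefix_transfer]. *)
rewrite -coef_prefix_sum prefix_sum_rec0 // -kirkman_sum_reciprocal.
have T := prefix_transfer ('X : {poly F}) n.
by rewrite (transfer_unique _ _ n _ _ (kirkman_transfer 1 'X n) T).
Qed.

End Rows.

Theorem theorem9p2 (R : realType) :
  (forall (n : nat) (Pi : seq (seq nat)),
     (1 <= n)%N -> Pi \in pattern_pairs ->
     [/\ asc_poly R n Pi = V R n.-1,
         des_poly R n Pi = reciprocal n.-1 (V R n.-1),
         polyseq (asc_poly R n Pi) = [seq c%:R | c <- A033282_row (n + 2)]
       & polyseq (des_poly R n Pi) = [seq c%:R | c <- A126216_row n]]) /\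
  (forall n : nat, (1 <= n)%N ->
     [/\ simple_negative_zeros (V R n.-1),
         simple_negative_zeros (reciprocal n.-1 (V R n.-1)),
         strictly_interlace (V R n.-1) (V R n)
       & strictly_interlace (reciprocal n.-1 (V R n.-1)) (reciprocal n (V R n))]).
Proof.
split=> [n Pi|]; last exact: V_real_rooted.
case: n => // n _ HPi; rewrite asc_poly_V // des_poly_V //; split=> //.
  exact: V_A033282.
exact: reciprocal_A126216.
Qed.
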